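(* Let $I$ be an ideal of a commutative Noetherian ring $R$ with non-zero identity. Let $\mathscr{FD}^1(R,I)_{cof}$ denote the category of $I$-cofinite $\mathrm{FD}_{\leq 1}$ $R$-modules. Then $\mathscr{FD}^1(R,I)_{cof}$ is an Abelian category.
   Context: $\mathscr{FD}^1(R,I)_{cof}$ is regarded as a full subcategory of the category of all $R$-modules, and the assertion is that it is an Abelian subcategory of the category of all $R$-modules: whenever $f:M\to N$ is an $R$-module homomorphism with $M,N$ in the subcategory, $\ker f$ and $\operatorname{coker} f$ are also in the subcategory. $V(I)=\{\mathfrak p\in\operatorname{Spec} R : \mathfrak p\supseteq I\}$. For a (not necessarily finitely generated) $R$-module $T$, $\dim T$ is the supremum of $\dim R/\mathfrak p$ over $\mathfrak p\in\operatorname{Supp} T$ (with $\dim 0=-1$). An $R$-module $L$ is called $\mathrm{FD}_{\leq 1}$ if there is a finitely generated submodule $L'$ of $L$ with $\dim (L/L')\leq 1$. An $R$-module $L$ is $I$-cofinite if $\operatorname{Supp}(L)\subseteq V(I)$ and $\operatorname{Ext}^i_R(R/I,L)$ is finitely generated for all $i\geq 0$. *)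

(* Defs.v *)
From HB Require Import structures.
From mathcomp Require Import all_boot all_order all_algebra.
From mathcomp Require Import generic_quotient ring_quotient.
From mathcomp Require Import boolp classical_sets functions.
From mathcomp Require Import ring.
From mathcomp.multinomials Require Import freeg.

Set Implicit Arguments.
Unset Strict Implicit.
Unset Printing Implicit Defensive.

Import GRing.Theory.
Local Open Scope ring_scope.
Local Open Scope quotient_scope.

(* Submodules are [submodClosed V], i.e. boolean predicates; with the axioms of
   [boolp], which make [`[< P >]] available, these are all the submodules.
   Ideals, proper or not, are the submodules of R^o; [prime_idealr] is used for
   primes, which are proper. *)

Section Submodule.
Variables (R : comNzRingType) (V : lmodType R) (S : submodClosed V).

Definition submod_of := {x : V | x \in S}.

HB.instance Definition _ := SubChoice.on submod_of.
HB.instance Definition _ := [SubChoice_isSubLmodule of submod_of by <:].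

Definition submod_incl (x : submod_of) : V := val x.

Fact submod_incl_is_linear : linear submod_incl.
Proof. by move=> a x y. Qed.
HB.instance Definition _ :=
  GRing.isLinear.Build R submod_of V *:%R submod_incl submod_incl_is_linear.

End Submodule.

Section QuotientModule.
Variables (R : comNzRingType) (V : lmodType R) (S : submodClosed V).

Fact submodClosed_zmod : zmod_closed (S : {pred V}).
Proof. exact: (GRing.submod_closedB (GRing.submodClosedP S)). Qed.

Definition zmod_of_submod : {pred V} := S.
HB.instance Definition _ :=
  GRing.isZmodClosed.Build V zmod_of_submod submodClosed_zmod.

Definition quotmod := Quotient.quot zmod_of_submod.
HB.instance Definition _ := GRing.Zmodule.on quotmod.
HB.instance Definition _ := EqQuotient.on quotmod.

Definition quotmod_pi (x : V) : quotmod := \pi_quotmod x.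

Fact quotmod_piD : {morph quotmod_pi : x y / x + y}.
Proof. exact: (Quotient.pi_add zmod_of_submod). Qed.

Definition quotmod_scale (a : R) : quotmod -> quotmod :=
  lift_op1 quotmod ( *:%R a).

Fact quotmod_piZ a :
  {morph quotmod_pi : x / a *: x >-> quotmod_scale a x}.
Proof.
move=> x; rewrite /quotmod_pi; unlock quotmod_scale; apply/eqP.
rewrite -(Quotient.idealrBE zmod_of_submod) -scalerBr; apply: (@rpredZ _ _ S).
by rewrite (Quotient.idealrBE zmod_of_submod) reprK.
Qed.

Fact quotmod_piK : cancel repr quotmod_pi.
Proof. exact: reprK. Qed.

Fact quotmod_scaleA a b (v : quotmod) :
  quotmod_scale a (quotmod_scale b v) = quotmod_scale (a * b) v.
Proof. by rewrite -[v]quotmod_piK -!quotmod_piZ scalerA. Qed.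

Fact quotmod_scale1 : left_id 1 quotmod_scale.
Proof. by move=> v; rewrite -[v]quotmod_piK -!quotmod_piZ scale1r. Qed.

Fact quotmod_scaleDr : right_distributive quotmod_scale +%R.
Proof.
move=> a u v; rewrite -[u]quotmod_piK -[v]quotmod_piK.
by rewrite -quotmod_piD -!quotmod_piZ -quotmod_piD scalerDr.
Qed.

Fact quotmod_scaleDl (v : quotmod) :
  {morph (fun a => quotmod_scale a v) : a b / a + b}.
Proof.
move=> a b; rewrite -[v]quotmod_piK.
by rewrite -!quotmod_piZ -quotmod_piD scalerDl.
Qed.

HB.instance Definition _ := GRing.Zmodule_isLmodule.Build R quotmod
  quotmod_scaleA quotmod_scale1 quotmod_scaleDr quotmod_scaleDl.

Fact quotmod_pi_is_linear : linear quotmod_pi.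
Proof. by move=> a x y; rewrite quotmod_piD quotmod_piZ. Qed.
HB.instance Definition _ :=
  GRing.isLinear.Build R V quotmod *:%R quotmod_pi quotmod_pi_is_linear.

End QuotientModule.

Section KernelImage.
Variables (R : comNzRingType) (U V : lmodType R) (f : {linear U -> V}).

Definition ker_pred : {pred U} := fun x => f x == 0.
Fact ker_pred_closed : submod_closed ker_pred.
Proof.
split=> [|a x y]; rewrite -?topredE /= /ker_pred ?linear0 // => /eqP fx /eqP fy.
by rewrite linearP fx fy scaler0 addr0.
Qed.
HB.instance Definition _ := GRing.isSubmodClosed.Build R U ker_pred
  ker_pred_closed.

Definition im_pred : {pred V} := fun y => `[< exists x, f x = y >].
Fact im_pred_closed : submod_closed im_pred.
Proof.
split=> [|a _ _ /asboolP[x <-] /asboolP[y <-]]; apply/asboolP.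
  by exists 0; rewrite linear0.
by exists (a *: x + y); rewrite linearP.
Qed.
HB.instance Definition _ := GRing.isSubmodClosed.Build R V im_pred
  im_pred_closed.

Definition kernel : lmodType R := submod_of ker_pred.
Definition cokernel : lmodType R := quotmod im_pred.

End KernelImage.

Section Cohomology.
Variables (R : comNzRingType) (U V W : lmodType R).
Variables (f : {linear U -> V}) (g : {linear V -> W}).

Definition boundary_pred : {pred submod_of (ker_pred g)} :=
  fun z => val z \in im_pred f.
Fact boundary_pred_closed : submod_closed boundary_pred.
Proof.
have [im0 imP] := im_pred_closed f.
by split=> [|a x y xB yB]; [exact: im0 | exact: imP].
Qed.
HB.instance Definition _ := GRing.isSubmodClosed.Build R _ boundary_pred
  boundary_pred_closed.

(* ker g / im f, for a complex U -f-> V -g-> W *)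
Definition cohomology : lmodType R := quotmod boundary_pred.

End Cohomology.

Section Hom.
Variables (R : comNzRingType) (U V : lmodType R).

Definition hom_pred : {pred U -> V} := fun f => `[< linear f >].
Fact hom_pred_closed : submod_closed hom_pred.
Proof.
split=> [|a f g /asboolP lf /asboolP lg]; apply/asboolP => b x y /=.
  by rewrite /0 /= scaler0 addr0.
change (a *: f (b *: x + y) + g (b *: x + y) =
  b *: (a *: f x + g x) + (a *: f y + g y)).
by rewrite lf lg !scalerDr !scalerA (mulrC a b) addrACA.
Qed.
HB.instance Definition _ := GRing.isSubmodClosed.Build R (U -> V) hom_pred
  hom_pred_closed.

Definition Hom : lmodType R := submod_of hom_pred.

End Hom.

Section HomDual.
Variables (R : comNzRingType) (U V L : lmodType R) (d : {linear U -> V}).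

Fact hom_dual_subproof (h : Hom V L) : (val h \o d : U -> L) \in @hom_pred R U L.
Proof.
apply/asboolP => a x y /=; have /asboolP lh := valP h.
by rewrite linearP lh.
Qed.

(* Hom(d, L) *)
Definition hom_dual (h : Hom V L) : Hom U L :=
  exist (fun g : U -> L => g \in @hom_pred R U L) _ (hom_dual_subproof h).

Fact hom_dual_is_linear : linear hom_dual.
Proof. by move=> a h k; apply: val_inj. Qed.
HB.instance Definition _ := GRing.isLinear.Build R (Hom V L) (Hom U L) *:%R
  hom_dual hom_dual_is_linear.

End HomDual.

Section Ext.
Variable R : comNzRingType.

(* the free module on the underlying set of M, and its canonical map onto M *)
Definition free_cover (M : lmodType R) : lmodType R := {freeg M / R}.
Definition free_aug (M : lmodType R) : free_cover M -> M := fglift idfun.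

Fact free_aug_is_additive (M : lmodType R) : additive (@free_aug M).
Proof. exact: lift_is_additive. Qed.
HB.instance Definition _ (M : lmodType R) :=
  GRing.isAdditive.Build (free_cover M) M (@free_aug M)
    (@free_aug_is_additive M).

Fact free_aug_is_scalable (M : lmodType R) : scalable (@free_aug M).
Proof.
move=> a D; pose s x : {freeg M / R} := << a * coeff x D *g x >>.
have -> : @free_aug M (a *: D) = \sum_(x <- dom D) free_aug (s x).
  exact: (raddf_sum (@free_aug M) (dom D) xpredT s).
rewrite -[in RHS](freeg_sumE D).
have -> : @free_aug M (\sum_(x <- dom D) << coeff x D *g x >>) =
    \sum_(x <- dom D) free_aug << coeff x D *g x >> by exact: raddf_sum.
by rewrite scaler_sumr; apply: eq_bigr => x _; rewrite /free_aug !liftU scalerA.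
Qed.
HB.instance Definition _ (M : lmodType R) :=
  GRing.isScalable.Build R (free_cover M) M *:%R (@free_aug M)
    (@free_aug_is_scalable M).

Fixpoint syzygy (M : lmodType R) (n : nat) : lmodType R :=
  if n is n'.+1 then kernel (@free_aug (syzygy M n')) else M.

(* The canonical free resolution
     ... -> free_res M 1 -> free_res M 0 -> M -> 0
   with [free_res_d M n : free_res M n.+1 -> free_res M n]. *)
Definition free_res (M : lmodType R) (n : nat) : lmodType R :=
  free_cover (syzygy M n).
Definition free_res_d (M : lmodType R) (n : nat) :
    {linear free_res M n.+1 -> free_res M n} :=
  @submod_incl R (free_res M n) _ \o @free_aug (syzygy M n.+1).

(* The n-th cohomology of Hom(free_res M, L). *)
Definition Ext (n : nat) (M L : lmodType R) : lmodType R :=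
  if n is n'.+1
  then cohomology (@hom_dual R _ _ L (free_res_d M n'))
                  (@hom_dual R _ _ L (free_res_d M n'.+1))
  else kernel (@hom_dual R _ _ L (free_res_d M 0)).

End Ext.

Section FinitelyGenerated.
Variable R : comNzRingType.

Definition fg_submod (V : lmodType R) (S : {pred V}) : Prop :=
  exists s : seq V, forall x : V,
    x \in S <-> exists c : 'I_(size s) -> R, x = \sum_i c i *: s`_i.

Definition fg_module (V : lmodType R) : Prop := fg_submod (predT : {pred V}).

Definition noetherian : Prop := forall J : submodClosed R^o, fg_submod J.

End FinitelyGenerated.

Section Localization.
Variables (R : comNzRingType) (p : prime_idealr R) (L : lmodType R).

Definition denom := {s : R | s \notin p}.

(* (x, s) ~ (y, t), i.e. x / s = y / t, iff u *: (t *: x - s *: y) = 0 for some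
   u outside p *)
Definition frac_eq (a b : L * denom) : bool :=
  `[< exists2 u : R, u \notin p &
        u *: (val b.2 *: a.1 - val a.2 *: b.1) = 0 >].

Fact frac_eq_equiv : equiv_class_of frac_eq.
Proof.
split=> [a | a b | b a c].
- by apply/asboolP; exists 1; rewrite ?idealr1 // subrr scaler0.
- by apply/asboolP/asboolP=> -[u pu e]; exists u => //;
    rewrite -opprB scalerN e oppr0.
move=> /asboolP[u pu e] /asboolP[v pv f]; apply/asboolP.
exists (u * v * val b.2); first by rewrite !prime_idealrM !negb_or pu pv (valP b.2).
transitivity ((v * val c.2) *: (u *: (val b.2 *: a.1 - val a.2 *: b.1)) +
              (u * val a.2) *: (v *: (val c.2 *: b.1 - val b.2 *: c.1))).
  rewrite !scalerBr !scalerA.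
  rewrite (_ : v * val c.2 * u * val a.2 = u * val a.2 * v * val c.2); last first.
    by ring.
  by rewrite addrA addrNK; congr (_ *: _ - _ *: _); ring.
by rewrite e f !scaler0 addr0.
Qed.
Canonical frac_eq_equivRel := EquivRelPack frac_eq_equiv.
Canonical frac_eq_encModRel := defaultEncModRel frac_eq.

(* the localization L_p, as a set of fractions *)
Definition localization := {eq_quot frac_eq}.

Fact one_notin_prime : 1 \notin p.
Proof. by rewrite idealr1. Qed.

Definition loc0 : localization :=
  \pi_localization (0, exist _ 1 one_notin_prime).

Definition in_supp : Prop := exists z : localization, z <> loc0.

End Localization.

Section Dimension.

Definition prime_chain (A : comNzRingType) (n : nat)
    (c : nat -> prime_idealr A) : Prop :=
  forall i, (i < n)%N -> {subset c i <= c i.+1} /\ ~ {subset c i.+1 <= c i}.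

(* dimensions are suprema, so that a bound on the dimension is an upper bound
   on the family whose supremum it is *)
Definition krull_dim_le (A : comNzRingType) (d : nat) : Prop :=
  forall (n : nat) (c : nat -> prime_idealr A), prime_chain n c -> (n <= d)%N.

(* dim L <= d; vacuous for L = 0, whose dimension is -1 *)
Definition dim_le (R : comNzRingType) (L : lmodType R) (d : nat) : Prop :=
  forall p : prime_idealr R, in_supp p L -> krull_dim_le {ideal_quot p} d.

End Dimension.

Section FDCofinite.
Variables (R : comNzRingType) (I : submodClosed R^o).

Definition in_V (p : prime_idealr R) : Prop :=
  {subset (I : {pred R}) <= (p : {pred R})}.

Definition cofinite (L : lmodType R) : Prop :=
  (forall p : prime_idealr R, in_supp p L -> in_V p) /\
  (forall i : nat, fg_module (Ext i (quotmod I) L)).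

Definition FD_le1 (L : lmodType R) : Prop :=
  exists S : submodClosed L, fg_submod S /\ dim_le (quotmod S) 1.

Definition FD1_cof (L : lmodType R) : Prop := cofinite L /\ FD_le1 L.

End FDCofinite.

(* C is the class of objects of a full subcategory of the category of all
   R-modules. *)
Definition abelian_subcategory (R : comNzRingType) (C : lmodType R -> Prop) :
    Prop :=
  forall (M N : lmodType R) (f : {linear M -> N}),
    C M -> C N -> C (kernel f) /\ C (cokernel f).

(* Main.v *)
From HB Require Import structures.
Require Import Defs.
From mathcomp Require Import all_boot all_order all_algebra.
From mathcomp Require Import generic_quotient ring_quotient.
From mathcomp Require Import boolp functions.
From mathcomp.multinomials Require Import freeg.

(* For M in FD_{<=1} with support in V(I), cofiniteness follows from the finite
   generation of Ext^0(R/I, M) and Ext^1(R/I, M) alone; the long exact sequences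
   of 0 -> ker f -> M -> im f -> 0 and 0 -> im f -> N -> coker f -> 0 then give
   the theorem.

   Dividing by a finitely generated submodule, one may assume dim M <= 1.
   Consider first dim M <= 0 and Ext^0 only, and let x be in I.  As 0 :_M I is
   finitely generated and M is I-torsion, M is artinian, so that
   N = x^n M = x N for some n.  By induction on the number of generators of I
   none of whose powers kills the module, 0 :_M x^n and 0 :_N x are cofinite.
   As x kills Ext^i(R/I, N) and x : N -> N is onto with cofinite kernel, N is
   cofinite, and so is M.  If dim M <= 1, the same argument works up to modules
   of dimension <= 0: M is artinian up to these, N / x N has dimension <= 0, and
   Ext^0(R/I, N / x N) is finitely generated because both Ext^0 and Ext^1 are
   controlled on M, so that N / x N is cofinite by the first case. *)

Set Implicit Arguments.
Unset Strict Implicit.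
Unset Printing Implicit Defensive.

Import GRing.Theory.
Local Open Scope ring_scope.
Local Open Scope quotient_scope.

(** * Finitely generated modules over a noetherian ring *)

Section SubmoduleProp.
Variable R : comNzRingType.

(** Prop-valued predicates spare the boolean reflection that [submodClosed] imposes on images,
    preimages and intersections; [of_submodp] converts back. *)
Definition submodp (V : lmodType R) (S : V -> Prop) : Prop :=
  S 0 /\ forall (a : R) x y, S x -> S y -> S (a *: x + y).

Section Closure.
Variables (V : lmodType R) (S : V -> Prop).
Hypothesis hS : submodp S.

Lemma submodp0 : S 0. Proof. by case: hS. Qed.

Lemma submodpD x y : S x -> S y -> S (x + y).
Proof. by move=> Sx Sy; rewrite -[x]scale1r; apply: hS.2. Qed.

Lemma submodpZ a x : S x -> S (a *: x).
Proof. by move=> Sx; rewrite -[_ *: _]addr0; apply: hS.2 => //; case: hS. Qed.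

Lemma submodpN x : S x -> S (- x).
Proof. by rewrite -scaleN1r; apply: submodpZ. Qed.

Lemma submodpB x y : S x -> S y -> S (x - y).
Proof. by move=> Sx Sy; apply: submodpD => //; apply: submodpN. Qed.

End Closure.

Variables (U V : lmodType R).

Lemma submodp_zero : submodp (eq^~ (0 : V)).
Proof. by split=> // a x y -> ->; rewrite scaler0 addr0. Qed.

Lemma submodp_setT : submodp (fun _ : V => True).
Proof. by []. Qed.

Lemma submodp_setI (S T : V -> Prop) :
  submodp S -> submodp T -> submodp (fun x => S x /\ T x).
Proof.
move=> hS hT; split=> [|a x y [Sx Tx] [Sy Ty]].
  by split; apply: submodp0.
by split; [apply: hS.2 | apply: hT.2].
Qed.

Lemma submodp_preim (f : {linear U -> V}) (S : V -> Prop) :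
  submodp S -> submodp (fun x => S (f x)).
Proof.
move=> hS; split=> [|a x y Sx Sy]; first by rewrite linear0; apply: submodp0.
by rewrite linearP; apply: hS.2.
Qed.

Lemma submodp_im (f : {linear U -> V}) (S : U -> Prop) :
  submodp S -> submodp (fun y => exists2 x, S x & f x = y).
Proof.
move=> hS; split=> [|a _ _ [x Sx <-] [y Sy <-]].
  by exists 0; rewrite ?linear0 //; apply: submodp0.
by exists (a *: x + y); rewrite ?linearP //; apply: hS.2.
Qed.

Lemma submodp_closed (S : submodClosed V) : submodp (fun x => x \in S).
Proof. by split=> [|a x y Sx Sy]; [exact: rpred0 | rewrite rpredD ?rpredZ]. Qed.

End SubmoduleProp.

Section FromProp.
Variables (R : comNzRingType) (V : lmodType R) (S : V -> Prop).
Hypothesis hS : submodp S.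

Definition submodp_pred of submodp S : {pred V} := fun x => `[< S x >].

Fact submodp_pred_closed : submod_closed (submodp_pred hS).
Proof.
split=> [|a x y /asboolP Sx /asboolP Sy]; apply/asboolP.
  exact: submodp0.
exact: hS.2.
Qed.
HB.instance Definition _ := GRing.isSubmodClosed.Build R V (submodp_pred hS)
  submodp_pred_closed.

Definition of_submodp : submodClosed V := submodp_pred hS.

Lemma of_submodpE x : x \in of_submodp <-> S x.
Proof. by split=> [/asboolP|? ]; last apply/asboolP. Qed.

End FromProp.

(** * Generation modulo a submodule *)

Section Generation.
Variable R : comNzRingType.

(** [gen s B] is the submodule [B + span s], by recursion on [s] to avoid indexed sums; in
    particular [gen [:: x] T] is T + Rx. *)
Fixpoint gen (V : lmodType R) (s : seq V) (B : V -> Prop) (z : V) : Prop :=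
  if s is x :: s' then exists a : R, gen s' B (z - a *: x) else B z.

(** For submodules this is finite generation of Z/(Z ∩ B), expressed without forming the
    subquotient. *)
Definition fgm (V : lmodType R) (Z B : V -> Prop) : Prop :=
  exists s : seq V, (forall x, x \in s -> Z x) /\ (forall z, Z z -> gen s B z).

Section Gen.
Variable V : lmodType R.
Implicit Types (s t : seq V) (B C : V -> Prop).

Lemma gen_cat s t B z : gen (s ++ t) B z <-> gen s (gen t B) z.
Proof.
elim: s z => [|x s IH] z //=.
by split=> -[a g]; exists a; apply/IH.
Qed.

Lemma gen_mono s B C z : (forall x, B x -> C x) -> gen s B z -> gen s C z.
Proof.
by move=> BC; elim: s z => [|x s IH] z /=; [exact: BC | move=> [a /IH g];
  exists a].
Qed.

Lemma gen_sub s B z : B z -> gen s B z.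
Proof. by elim: s z => [|x s IH] z Bz //=; exists 0; apply: IH;
  rewrite scale0r subr0. Qed.

Lemma gen_submodp s B : submodp B -> submodp (gen s B).
Proof.
move=> hB; elim: s => [|x s IH] //=; split.
  by exists 0; rewrite scale0r subr0; apply: submodp0.
move=> a y z [b gy] [c gz]; exists (a * b + c).
rewrite scalerDl -scalerA opprD addrACA -scalerBr; exact: IH.2.
Qed.

Lemma gen_mem s B x : submodp B -> x \in s -> gen s B x.
Proof.
move=> hB; elim: s => //= y s IH; rewrite inE => /predU1P[->|xs].
  by exists 1; rewrite scale1r subrr; apply: submodp0; apply: gen_submodp.
by exists 0; rewrite scale0r subr0; apply: IH.
Qed.

Lemma gen_min s B C z : submodp C -> (forall x, x \in s -> C x) ->
  (forall x, B x -> C x) -> gen s B z -> C z.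
Proof.
move=> hC sC BC; elim: s sC z => [|x s IH] sC z /=; first exact: BC.
move=> [a g]; rewrite -[z](subrK (a *: x)); apply: submodpD => //.
  by apply: IH => // y ys; apply: sC; rewrite inE ys orbT.
by apply: submodpZ => //; apply: sC; rewrite mem_head.
Qed.

Lemma gen_cat_sub s t B y z :
  gen s (eq^~ 0) y -> gen t B (z - y) -> gen (s ++ t) B z.
Proof.
move=> gy gz; apply/gen_cat; elim: s y gy z gz => [|x s IH] y /=.
  by move=> -> z; rewrite subr0.
move=> [a gy] z gz; exists a; apply: (IH _ gy).
by rewrite opprB addrA subrK.
Qed.

Lemma genP s z : gen s (eq^~ 0) z <->
  exists c : 'I_(size s) -> R, z = \sum_i c i *: s`_i.
Proof.
elim: s z => [|x s IH] z /=.
  by split=> [->|[c ->]]; [exists (fun=> 0)|]; rewrite big_ord0.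
split=> [[a /IH [c e]]|[c ->]].
  exists (fun i : 'I_(size s).+1 => oapp c a (unlift ord0 i)).
  rewrite big_ord_recl unlift_none /= -[z](subrK (a *: x)) e addrC.
  by congr (_ + _); apply: eq_bigr => i _; rewrite liftK.
exists (c (@ord0 (size s))); apply/IH;
  exists (fun i : 'I_(size s) => c (fintype.lift ord0 i)).
by rewrite big_ord_recl /= addrC addKr.
Qed.

End Gen.

Section GenMap.
Variables (U V : lmodType R) (f : {linear U -> V}).

Lemma gen_map s (B : U -> Prop) (C : V -> Prop) z :
  (forall x, B x -> C (f x)) -> gen s B z -> gen (map f s) C (f z).
Proof.
move=> BC; elim: s z => [|x s IH] z /=; first exact: BC.
by move=> [a /IH g]; exists a; rewrite -linearZ -linearB.
Qed.

Lemma gen_map_inv s (C : V -> Prop) z : gen (map f s) C (f z) ->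
  gen s (fun x => C (f x)) z.
Proof.
elim: s z => [|x s IH] z //= [a]; rewrite -linearZ -linearB => /IH g.
by exists a.
Qed.

Lemma seq_preim (P : U -> Prop) (s : seq V) :
  (forall y, y \in s -> exists2 x, P x & f x = y) ->
  exists2 t, (forall x, x \in t -> P x) & map f t = s.
Proof.
elim: s => [|y s IH] sP; first by exists [::].
have [x Px fx] := sP y (mem_head _ _).
have [|t tP ft] := IH; first by move=> z zs; apply: sP; rewrite inE zs orbT.
exists (x :: t) => [z|/=]; last by rewrite fx ft.
by rewrite inE => /predU1P[->|/tP].
Qed.

Lemma fgm_im (Z B : U -> Prop) (Z' B' : V -> Prop) :
  submodp B' -> (forall x, Z x -> Z' (f x)) -> (forall x, B x -> B' (f x)) ->
  (forall y, Z' y -> exists2 x, Z x & B' (y - f x)) ->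
  fgm Z B -> fgm Z' B'.
Proof.
move=> hB' ZZ BB onto [s [sZ gZ]]; exists (map f s); split.
  by move=> _ /mapP[x /sZ /ZZ Zx ->].
move=> y /onto[x /gZ gx Bx]; rewrite -[y](subrK (f x)).
apply: submodpD; first exact: gen_submodp.
  exact: gen_sub.
by apply: gen_map gx.
Qed.

End GenMap.

Lemma fgm_sub (V : lmodType R) (Z B C : V -> Prop) :
  (forall x, B x -> C x) -> fgm Z B -> fgm Z C.
Proof.
move=> BC [s [sZ gZ]]; exists s; split=> // z /gZ; exact: gen_mono.
Qed.

Lemma fgm_same (V : lmodType R) (Z Z' B B' : V -> Prop) :
  (forall x, Z x <-> Z' x) -> (forall x, B x -> B' x) -> fgm Z B -> fgm Z' B'.
Proof.
move=> ZZ BB [s [sZ gZ]]; exists s; split=> [x /sZ /ZZ //|z /ZZ /gZ].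
exact: gen_mono.
Qed.

Lemma fgm_ext (V : lmodType R) (Z W B : V -> Prop) :
  (forall z, Z z -> exists2 w, W w & B (z - w)) -> (forall w, W w -> Z w) ->
  submodp B -> fgm W B -> fgm Z B.
Proof.
by move=> ZW WZ hB; apply: (@fgm_im V V idfun W B Z B hB WZ).
Qed.

Lemma fgm_triv (V : lmodType R) (Z B : V -> Prop) :
  (forall z, Z z -> B z) -> fgm Z B.
Proof. by move=> ZB; exists [::]. Qed.

Lemma fg_moduleP (V : lmodType R) :
  fg_module V <-> fgm (fun _ : V => True) (eq^~ 0).
Proof.
split=> [[s sP]|[s [_ sP]]]; exists s.
  by split=> // z _; apply/genP/sP.
by move=> x; split=> // _; apply/genP/sP.
Qed.

Lemma fg_submodP (V : lmodType R) (S : submodClosed V) :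
  fg_submod S <-> fgm (fun x => x \in S) (eq^~ 0).
Proof.
split=> [[s sP]|[s [sS sP]]]; exists s.
  split=> [x xs|z /sP /genP //].
  by apply/sP/genP; apply: gen_mem => //; exact: submodp_zero.
move=> x; split=> [/sP/genP //|/genP gx].
apply: (gen_min (submodp_closed S) sS _ gx) => _ ->; exact: rpred0.
Qed.

End Generation.

Section Noetherian.
Variable R : comNzRingType.
Hypothesis hR : noetherian R.

Lemma noetherian_fgm (J : R^o -> Prop) : submodp J -> fgm J (eq^~ 0).
Proof.
move=> hJ; apply: (fgm_same _ _ ((fg_submodP _).1 (hR (of_submodp hJ)))) => //
  x.
exact: of_submodpE.
Qed.

Section Fgm.
Variables (V : lmodType R) (B : V -> Prop).
Hypothesis hB : submodp B.

(** Induction on the number of generators of the ambient module, splitting off the coefficient at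
    the first one. *)
Lemma fgm_of_gen (s : seq V) (Z : V -> Prop) :
  submodp Z -> (forall z, Z z -> gen s B z) -> fgm Z B.
Proof.
elim: s Z => [|x s IH] Z hZ Zs; first exact: fgm_triv.
have hs : submodp (gen s B) by exact: gen_submodp.
(* The ideal of coefficients at [x] of elements of [Z], modulo the other generators; generators of
   [J] are lifted to a list [zs] in [Z]. *)
pose J (a : R^o) := exists2 z, Z z & gen s B (z - (a : R) *: x).
have hJ : submodp J.
  split=> [|a b c [y Zy gy] [z Zz gz]].
    by exists 0; [exact: submodp0 | rewrite scale0r subr0; exact: submodp0].
  exists (a *: y + z); first exact: hZ.2.
  rewrite scalerDl -scalerA opprD addrACA -scalerBr; exact: hs.2.
have [l [lJ lgen]] := noetherian_fgm hJ.
have [zs zsZ zsP] : exists2 zs, (forall z, z \in zs -> Z z) &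
    forall a : R^o, gen l (eq^~ 0) a ->
      exists2 z, gen zs (eq^~ 0) z & gen s B (z - (a : R) *: x).
  elim: l lJ {lgen} => [|b l IHl] lJ.
    exists [::] => // a /= ->.
    by exists 0 => //; rewrite scale0r subr0; apply: submodp0.
  have [|zs zsZ zsP] := IHl; first by move=> c cl; apply: lJ;
    rewrite inE cl orbT.
  have [y Zy gy] := lJ b (mem_head _ _).
  exists (y :: zs) => [z|a /= [c /zsP[z gz sz]]].
    by rewrite inE => /predU1P[->|/zsZ].
  exists (z + c *: y); first by exists c; rewrite addrK.
  rewrite -[a](subrK (c *: b)) scalerDl -scalerA opprD addrACA -scalerBr.
  by apply: submodpD => //; apply: submodpZ.
(* Subtracting a combination of [zs] from an element of [Z] leaves an element of this smaller
   submodule. *)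
have [||ts [tsZ tsP]] := IH (fun z => Z z /\ gen s B z).
- exact: submodp_setI.
- by move=> z [].
exists (zs ++ ts); split=> [z|z Zz].
  by rewrite mem_cat => /orP[/zsZ|/tsZ []].
have [a ga] := Zs _ Zz.
have [|y gy ya] := zsP a; first by apply: lgen; exists z.
apply: (gen_cat_sub gy); apply: tsP; split.
  apply: submodpB => //; apply: gen_min gy => // _ ->; exact: submodp0.
rewrite (_ : z - y = (z - a *: x) - (y - a *: x)); first exact: submodpB.
by rewrite opprB addrA subrK.
Qed.

Lemma fgm_subset (Z W : V -> Prop) :
  submodp Z -> (forall z, Z z -> W z) -> fgm W B -> fgm Z B.
Proof. by move=> hZ ZW [s [_ sW]]; apply: (@fgm_of_gen s) => // z /ZW /sW. Qed.

End Fgm.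

(** [Z] is an extension of its image modulo [B'], finitely generated by noetherianity, by the part
    that [f] sends into [B']. *)
Lemma fgm_kernel (U V : lmodType R) (f : {linear U -> V})
    (Z B : U -> Prop) (Z' B' : V -> Prop) :
  submodp Z -> submodp B' -> (forall z, Z z -> Z' (f z)) -> fgm Z' B' ->
  fgm (fun z => Z z /\ B' (f z)) B -> fgm Z B.
Proof.
move=> hZ hB' ZZ fg' [t [tZ tP]].
have [s' [s'im s'P]] : fgm (fun y => exists2 x, Z x & f x = y) B'.
  apply: (fgm_subset _ _ _ fg') => //; first exact: submodp_im.
  by move=> _ [z /ZZ Zz <-].
have [s sZ fs] := seq_preim s'im.
exists (s ++ t); split=> [z|z Zz].
  by rewrite mem_cat => /orP[/sZ|/tZ []].
have : gen (map f s) B' (f z) by rewrite fs; apply: s'P; exists z.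
move=> /gen_map_inv g.
have {g} [y gy By] : exists2 y, gen s (eq^~ 0) y & B' (f (z - y)).
  elim: s {sZ fs} z {Zz} g => [|x s IH] z /=.
    by exists 0; rewrite ?subr0.
  move=> [a /IH[y gy By]]; exists (y + a *: x); first by exists a;
    rewrite addrK.
  by rewrite opprD addrCA addrC.
apply: (gen_cat_sub gy); apply: tP; split=> //.
apply: submodpB => //; apply: gen_min gy => // _ ->; exact: submodp0.
Qed.

End Noetherian.

(** * Cochains of the canonical free resolution *)

Section FreeLift.
Variables (R : comNzRingType) (T : choiceType) (L : lmodType R) (c : T -> L).

Definition flift : {freeg T / R} -> L := fglift c.

Lemma fliftE x : flift << x >> = c x.
Proof. by rewrite /flift liftU scale1r. Qed.

Fact flift_is_additive : additive flift.
Proof. exact: lift_is_additive. Qed.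
HB.instance Definition _ :=
  GRing.isAdditive.Build {freeg T / R} L flift flift_is_additive.

Fact flift_is_scalable : scalable flift.
Proof.
move=> a D; pose s x : {freeg T / R} := << a * coeff x D *g x >>.
have -> : flift (a *: D) = \sum_(x <- dom D) flift (s x).
  exact: (raddf_sum flift (dom D) xpredT s).
rewrite -[in RHS](freeg_sumE D).
have -> : flift (\sum_(x <- dom D) << coeff x D *g x >>) =
    \sum_(x <- dom D) flift << coeff x D *g x >> by exact: raddf_sum.
by rewrite scaler_sumr; apply: eq_bigr => x _; rewrite /flift !liftU scalerA.
Qed.
HB.instance Definition _ :=
  GRing.isScalable.Build R {freeg T / R} L *:%R flift flift_is_scalable.

Lemma freeg_ind (P : {freeg T / R} -> Prop) :
  submodp P -> (forall x, P << x >>) -> forall D, P D.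
Proof.
move=> hP Px D; rewrite -[D]freeg_sumE; elim: (dom D) => [|x s IH].
  by rewrite big_nil; apply: submodp0.
rewrite big_cons (_ : << coeff x D *g x >> = coeff x D *: << x >>).
  exact: hP.2.
by apply/eqP/freeg_eqP => y; rewrite coeffZ !coeffU mul1r.
Qed.

Lemma flift_unique (h : {linear {freeg T / R} -> L}) :
  (forall x, h << x >> = c x) -> flift =1 h.
Proof.
move=> hc; apply: freeg_ind => [|x]; last by rewrite fliftE hc.
by split=> [|a x y ex ey]; rewrite ?linear0 // !linearP /= ex ey.
Qed.

End FreeLift.

(** Free modules are projective: lifts of the images of the basis elements are chosen. *)
Lemma freeg_lift_surj (R : comNzRingType) (T : choiceType) (U V : lmodType R)
    (g : {linear U -> V}) (h : {linear {freeg T / R} -> V}) :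
  (forall y, exists x, g x = y) ->
  exists k : {linear {freeg T / R} -> U}, forall D, g (k D) = h D.
Proof.
move=> g_surj; have [c cP] := choice (fun t : T => g_surj (h << t >>)).
exists (@flift R T U c) => D.
pose gc : {linear {freeg T / R} -> V} := g \o @flift R T U c.
rewrite -[g _]/(gc D) -(@flift_unique _ _ _ (fun t => h << t >>) gc) => [|t].
  exact: (@flift_unique _ _ _ _ h).
by rewrite /= fliftE.
Qed.

Definition short_exact (R : comNzRingType) (L1 L2 L3 : lmodType R)
    (f : {linear L1 -> L2}) (g : {linear L2 -> L3}) : Prop :=
  [/\ forall x, f x = 0 -> x = 0, forall z, exists y, g y = z
    & forall y, g y = 0 <-> exists x, f x = y].

Section Post.
Variables (R : comNzRingType) (T : Type) (U V : lmodType R).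
Variable f : {linear U -> V}.

Definition post (c : T -> U) : T -> V := f \o c.

Fact post_is_linear : linear post.
Proof. by move=> a c1 c2; apply/funext => x; rewrite /post /= linearP. Qed.
HB.instance Definition _ :=
  GRing.isLinear.Build R (T -> U) (T -> V) *:%R post post_is_linear.

End Post.

Section Cochains.
Variables (R : comNzRingType) (M : lmodType R).

(* [cell n.+1] is the basis of the module in degree [n] of the canonical free
   resolution of [M], so that [cell n.+1 -> L] is Hom(free_res M n, L); the
   empty [cell 0] is a dummy degree that spares a case distinction. *)
Definition cell (n : nat) : Type := if n is n'.+1 then syzygy M n' else void.

(** The differential of Hom(free_res M, L) on basis elements: a cell of the next degree is a syzygy,
    hence a combination of cells, to which [c] extends linearly. *)
Definition cobd (L : lmodType R) (n : nat) : (cell n -> L) -> cell n.+1 -> L :=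
  match n with
  | 0 => fun _ _ => 0
  | n'.+1 => fun (c : syzygy M n' -> L) (s : syzygy M n'.+1) =>
               flift c (submod_incl s)
  end.

Lemma cobd_is_linear (L : lmodType R) n : linear (@cobd L n).
Proof.
case: n => [|n] a c1 c2; apply/funext => s /=; first by rewrite scaler0 addr0.
pose h : {freeg (syzygy M n) / R} -> L := fun D => a *: flift c1 D + flift c2 D.
have lh : linear h.
  move=> b x y; rewrite /h (linearP (flift c1)) (linearP (flift c2)) /=.
  by rewrite !scalerDr !scalerA (mulrC a b) addrACA.
pose hL := GRing.isLinear.Build R {freeg (syzygy M n) / R} L *:%R h lh.
pose H : {linear {freeg (syzygy M n) / R} -> L} := HB.pack h hL.
have /= -> // := @flift_unique _ _ _ (a *: c1 + c2) H.
by move=> x; rewrite /= /h !fliftE.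
Qed.
HB.instance Definition _ (L : lmodType R) n :=
  GRing.isLinear.Build R (cell n -> L) (cell n.+1 -> L) *:%R (@cobd L n)
    (@cobd_is_linear L n).

Lemma cobd_post (U V : lmodType R) (f : {linear U -> V}) n (c : cell n -> U) :
  cobd (post f c) = post f (cobd c).
Proof.
case: n c => [|n] c; apply/funext => s /=; first by rewrite /post /= linear0.
pose fc : {linear {freeg (syzygy M n) / R} -> V} := f \o flift c.
have /= -> // := @flift_unique _ _ _ (post f c) fc.
by move=> x; rewrite /= fliftE.
Qed.

(** The linear extension of [cobd c] factors through the augmentation, which vanishes on the next
    syzygies. *)
Lemma cobdK (L : lmodType R) n (c : cell n -> L) : cobd (cobd c) = 0.
Proof.
case: n c => [|n] c; apply/funext => s.
  rewrite (_ : cobd c = 0) ?linear0 //.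
pose h : {linear {freeg (syzygy M n.+1) / R} -> L} :=
  flift c \o (@submod_incl R (free_cover (syzygy M n)) _ \o
    @free_aug R (syzygy M n.+1)).
rewrite [LHS](@flift_unique _ _ _ _ h) => [|x].
  rewrite /h /= (_ : free_aug _ = 0) ?linear0 //.
  exact/eqP/(valP s).
by rewrite /h /= /free_aug liftU scale1r.
Qed.

Definition cocycle (L : lmodType R) n (c : cell n -> L) : Prop := cobd c = 0.

(** In degree 1 the only coboundary is 0, since [cobd] is zero on the dummy degree. *)
Definition coboundary (L : lmodType R) n : (cell n -> L) -> Prop :=
  if n is n'.+1 return (cell n -> L) -> Prop
  then fun c => exists u, cobd u = c else fun _ => True.

(** The degree is shifted by one: [fgH L n.+1] is finite generation of Ext^n(M, L), by [fg_Ext]. *)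
Definition fgH (L : lmodType R) n : Prop :=
  fgm (@cocycle L n) (@coboundary L n).

Lemma cocycle_submodp (L : lmodType R) n : submodp (@cocycle L n).
Proof. exact: (submodp_preim (@cobd L n) (submodp_zero _)). Qed.

Lemma coboundary_submodp (L : lmodType R) n : submodp (@coboundary L n).
Proof.
case: n => [|n] //; split=> [|a _ _ [x <-] [y <-]].
  by exists 0; rewrite linear0.
by exists (a *: x + y); rewrite linearP.
Qed.

Lemma coboundary_cocycle (L : lmodType R) n (c : cell n -> L) :
  coboundary c -> cocycle c.
Proof.
case: n c => [|n] c; last by move=> [u <-]; apply: cobdK.
by move=> _; apply/funext.
Qed.

Lemma fgH0 (L : lmodType R) : fgH L 0.
Proof. exact: fgm_triv. Qed.

Section Functoriality.
Variables (U V : lmodType R) (f : {linear U -> V}) (n : nat).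
Implicit Types c : cell n -> U.

Lemma cocycle_post c : cocycle c -> cocycle (post f c).
Proof. by rewrite /cocycle cobd_post => ->; rewrite linear0. Qed.

Lemma coboundary_post c : coboundary c -> coboundary (post f c).
Proof. by case: n c => [|m] c // [u <-]; exists (post f u);
  rewrite cobd_post. Qed.

Hypothesis f_inj : forall x, f x = 0 -> x = 0.

Lemma post_eq0 (T : Type) (c : T -> U) : post f c = 0 -> c = 0.
Proof.
by move=> e; apply/funext => x; apply: f_inj; exact: (congr1 (@^~ x) e).
Qed.

Lemma post_inj (T : Type) : injective (@post R T U V f).
Proof.
move=> c1 c2 e; apply/eqP; rewrite -subr_eq0; apply/eqP/post_eq0.
by rewrite linearB /= e subrr.
Qed.

Lemma cocycle_post_inj c : cocycle (post f c) -> cocycle c.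
Proof. by rewrite /cocycle cobd_post; apply: post_eq0. Qed.

End Functoriality.

Lemma post_surj (T : Type) (U V : lmodType R) (g : {linear U -> V}) :
  (forall y, exists x, g x = y) -> forall c : T -> V, exists u, post g u = c.
Proof.
move=> g_surj c; have [u uP] := choice (fun t => g_surj (c t)).
by exists u; apply/funext.
Qed.

Lemma post_lift (T : Type) (L1 L2 L3 : lmodType R) (f : {linear L1 -> L2})
    (g : {linear L2 -> L3}) : short_exact f g ->
  forall c : T -> L2, post g c = 0 <-> exists u, post f u = c.
Proof.
move=> [f_inj g_surj fg] c; split=> [e|[u <-]].
  have [|u uP] := @choice T L1 (fun t x => f x = c t); last first.
    by exists u; apply/funext.
  by move=> t; apply/fg; exact: (congr1 (@^~ t) e).
by apply/funext => t; apply/fg; exists (u t).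
Qed.

(** * The long exact cohomology sequence *)

Section LongExactSequence.
Hypothesis hR : noetherian R.
Variables (L1 L2 L3 : lmodType R).
Variables (f : {linear L1 -> L2}) (g : {linear L2 -> L3}).
Hypothesis fg : short_exact f g.

Let f_inj : forall x, f x = 0 -> x = 0. Proof. by case: fg. Qed.
Let g_surj : forall z, exists y, g y = z. Proof. by case: fg. Qed.

Lemma coboundary_lift n (c : cell n -> L3) : coboundary c ->
  exists2 b, coboundary b & post g b = c.
Proof.
case: n c => [|n] c; first by exists 0 => //; apply/funext.
move=> [u <-]; have [v <-] := post_surj g_surj u.
by exists (cobd v); [exists v | rewrite cobd_post].
Qed.

(** Exactness at H^n(L2): after subtracting a coboundary that lifts [post g c], the cocycle [c]
    comes from [L1]. *)
Lemma fgm_ker_post n : fgH L1 n ->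
  fgm (fun c : cell n -> L2 => cocycle c /\ coboundary (post g c))
      (@coboundary L2 n).
Proof.
apply: (fgm_im (f := post f)); first exact: coboundary_submodp.
- move=> c Zc; split; first exact: cocycle_post.
  rewrite (_ : post g _ = 0); first exact: (submodp0 (coboundary_submodp _ _)).
  by apply/(post_lift fg); exists c.
- by move=> c; apply: coboundary_post.
move=> c [Zc /coboundary_lift[b Bb e]].
have [u uP] : exists u, post f u = c - b.
  by apply/(post_lift fg); rewrite linearB /= e subrr.
exists u; last by rewrite /= uP subKr.
apply: (cocycle_post_inj f_inj); rewrite uP.
apply: submodpB Zc _; first exact: cocycle_submodp.
exact: coboundary_cocycle.
Qed.

Lemma fgm_pull (U V : lmodType R) (h : {linear U -> V}) (Z B : V -> Prop) :
  submodp Z -> submodp B -> fgm Z B -> fgm (fun u => Z (h u)) (fun u => B (h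
    u)).
Proof.
move=> hZ hB ZB; apply: (fgm_kernel hR (f := h) _ hB _ ZB) => //.
  exact: submodp_preim.
by apply: fgm_triv => u [].
Qed.

(** Exactness at H^{n+1}(L1): the kernel of H^{n+1}(L1) -> H^{n+1}(L2) is the image of the
    connecting map from H^n(L3). *)
Lemma fgm_im_post n : fgH L3 n ->
  fgm (fun c : cell n.+1 -> L1 => cocycle c /\ coboundary (post f c))
      (@coboundary L1 n.+1).
Proof.
move=> /(fgm_pull (post g) (cocycle_submodp _ _) (coboundary_submodp _ _)).
(* As [f] is injective, the kernel may be studied through its image [Y] in cochains of [L2], modulo
   [fB]. *)
pose fB y := exists2 c : cell n.+1 -> L1, coboundary c & post f c = y.
have hfB : submodp fB by apply: submodp_im; exact: coboundary_submodp.
pose Y y := exists2 c : cell n.+1 -> L1,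
  cocycle c /\ coboundary (post f c) & post f c = y.
move=> Zg; have : fgm Y fB.
  (* On lifts to [L2] of cocycles of [L3], [cobd] is the connecting map. *)
  apply: (fgm_im (f := @cobd L2 n) _ _ _ _ Zg) => //.
  - move=> c; rewrite /cocycle cobd_post => /(post_lift fg)[z zP];
    exists z => //.
    split; last by rewrite zP; exists c.
    by apply: (cocycle_post_inj f_inj); rewrite zP; apply: cobdK.
  - move=> c /coboundary_lift[b Bb e].
    have [t tP] : exists t, post f t = c - b.
      by apply/(post_lift fg); rewrite linearB /= e subrr.
    exists (cobd t); first by exists t.
    by rewrite -cobd_post tP linearB /= (coboundary_cocycle Bb) subr0.
  move=> _ [z [Zz [u du]] <-]; exists u; last by rewrite /= du subrr;
    exact: submodp0.
  by rewrite /cocycle cobd_post du; apply/(post_lift fg); exists z.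
move=> YfB; apply: (fgm_kernel hR (f := post f) _ hfB _ YfB).
- apply: submodp_setI; first exact: cocycle_submodp.
  exact: (submodp_preim (post f) (coboundary_submodp _ _)).
- by move=> z Zz; exists z.
by apply: fgm_triv => z [_ [c Bc /(post_inj f_inj) <-]].
Qed.

Lemma fgH_mid n : fgH L1 n -> fgH L3 n -> fgH L2 n.
Proof.
move=> H1 H3; apply: (fgm_kernel hR (f := post g) _ _ _ H3).
- exact: cocycle_submodp.
- exact: coboundary_submodp.
- exact: cocycle_post.
exact: fgm_ker_post.
Qed.

Lemma fgH_left n : fgH L2 n.+1 -> fgH L3 n -> fgH L1 n.+1.
Proof.
move=> H2 H3; apply: (fgm_kernel hR (f := post f) _ _ _ H2).
- exact: cocycle_submodp.
- exact: coboundary_submodp.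
- exact: cocycle_post.
exact: fgm_im_post.
Qed.

Lemma fgH_right n : fgH L2 n -> fgH L1 n.+1 -> fgH L3 n.
Proof.
move=> H2 H1.
pose fB y := exists2 c : cell n.+1 -> L1, coboundary c & post f c = y.
have hfB : submodp fB by apply: submodp_im; exact: coboundary_submodp.
pose Z (u : cell n -> L2) := cocycle (post g u).
(* The lifts of cocycles of [L3] are analysed by the connecting map: its values come from cocycles
   of [L1], and a lift in its kernel is a cocycle of [L2] plus a cochain from [L1]. *)
have ZP : fgm Z (fun u => coboundary (post g u)).
  apply: (fgm_kernel hR (f := @cobd L2 n) (B' := fB)
    (Z' := fun y => exists2 c, cocycle c & post f c = y)) => //.
  - exact: (submodp_preim (post g) (cocycle_submodp _ _)).
  - move=> c; rewrite /Z /cocycle cobd_post => /(post_lift fg)[z zP].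
    exists z => //; apply: (cocycle_post_inj f_inj); rewrite zP; exact: cobdK.
  - apply: (fgm_im (f := post f) _ _ _ _ H1) => //.
    + by move=> c Zc; exists c.
    + by move=> c Bc; exists c.
    by move=> _ [c Zc <-]; exists c => //; rewrite subrr; exact: submodp0.
  apply: (@fgm_ext _ _ _ (@cocycle L2 n)) (fgm_sub _ H2).
  - move=> u [Zu [_ [t <-]]]; rewrite -cobd_post => e.
    exists (u - post f t); first by rewrite /cocycle linearB /= e subrr.
    rewrite subKr (_ : post g _ = 0);
      first exact: (submodp0 (coboundary_submodp _ _)).
    by apply/(post_lift fg); exists t.
  - move=> u Zu; split; first exact: cocycle_post.
    by rewrite /= Zu; exact: submodp0.
  - exact: (submodp_preim (post g) (coboundary_submodp _ _)).
  by move=> u; apply: coboundary_post.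
apply: (fgm_im (f := post g) _ _ _ _ ZP) => //; first exact: coboundary_submodp.
move=> c Zc; have [u uP] := post_surj g_surj c.
exists u; rewrite /Z /= uP // subrr; exact: (submodp0 (coboundary_submodp _ _)).
Qed.

End LongExactSequence.

(* If the endomorphism [b \o a] of [N] annihilates cohomology then, modulo
   finitely generated modules, the maps induced by [a] and [b] are both
   injective with composite 0. *)
Lemma fgH_nilpotent (hR : noetherian R) (K N Q C : lmodType R)
    (i : {linear K -> N}) (a : {linear N -> Q})
    (b : {linear Q -> N}) (p : {linear N -> C}) n :
  short_exact i a -> short_exact b p ->
  (forall c : cell n.+1 -> N, cocycle c -> coboundary (post b (post a c))) ->
  fgH K n.+1 -> fgH C n -> fgH N n.+1.
Proof.
move=> ia bp ba0 HK /(fgm_im_post hR bp) HC.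
apply: (fgm_kernel hR (f := post a) _ _ _ HC).
- exact: cocycle_submodp.
- exact: coboundary_submodp.
- by move=> c Zc; split; [exact: cocycle_post | exact: ba0].
exact: (fgm_ker_post ia).
Qed.

End Cochains.

(** * Ext in terms of cochains *)

Section Quotients.
Variables (R : comNzRingType) (V : lmodType R) (S : submodClosed V).

Lemma quotmod_pi_eq0 x : quotmod_pi S x = 0 <-> x \in S.
Proof.
rewrite -{1}(linear0 (@quotmod_pi _ _ S)) -{2}[x]subr0.
have := Quotient.idealrBE (zmod_of_submod S) x 0.
rewrite /quotmod_pi => e; split=> [/eqP|xS].
  by rewrite -e.
by apply/eqP; rewrite -e.
Qed.

Lemma quotmod_pi_surj (y : quotmod S) : exists x, quotmod_pi S x = y.
Proof. by exists (repr y); exact: quotmod_piK. Qed.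

Lemma short_exact_quotmod :
  short_exact (@submod_incl _ _ S) (@quotmod_pi _ _ S).
Proof.
split=> [x x0|y|y]; first exact: val_inj.
  exact: quotmod_pi_surj.
rewrite quotmod_pi_eq0; split=> [yS|[x <-]]; last exact: valP.
by exists (exist _ y yS).
Qed.

End Quotients.

Definition image (R : comNzRingType) (U V : lmodType R) (f : {linear U -> V}) :
  lmodType R := submod_of (im_pred f).

Section Image.
Variables (R : comNzRingType) (U V : lmodType R) (f : {linear U -> V}).

Fact to_image_subproof x : f x \in im_pred f.
Proof. by apply/asboolP; exists x. Qed.

Definition to_image (x : U) : image f :=
  exist (fun y => y \in im_pred f) _ (to_image_subproof x).

Fact to_image_is_linear : linear to_image.
Proof. by move=> a x y; apply: val_inj; rewrite /= linearP. Qed.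
HB.instance Definition _ := GRing.isLinear.Build R U (image f) *:%R to_image
  to_image_is_linear.

Lemma short_exact_kernel :
  short_exact (@submod_incl _ _ (ker_pred f)) to_image.
Proof.
split=> [x x0|[y yf]|y]; first exact: val_inj.
  by have /asboolP[x fx] := yf; exists x; apply: val_inj.
split=> [/(congr1 val) /= fy|[[x fx] /= <-]].
  have yf : y \in ker_pred f by exact/eqP.
  by exists (exist _ y yf).
by apply: val_inj; exact/eqP.
Qed.

Lemma short_exact_cokernel :
  short_exact (@submod_incl _ _ (im_pred f)) (@quotmod_pi _ _ (im_pred f)).
Proof. exact: short_exact_quotmod. Qed.

End Image.

Section ExtCochain.
Variable R : comNzRingType.
Hypothesis hR : noetherian R.

Lemma fgm_equiv (U V : lmodType R) (f : {linear U -> V})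
    (Z B : U -> Prop) (Z' B' : V -> Prop) :
  submodp Z' -> submodp B' ->
  (forall u, Z u <-> Z' (f u)) -> (forall u, B u <-> B' (f u)) ->
  (forall v, Z' v -> exists u, f u = v) ->
  fgm Z B <-> fgm Z' B'.
Proof.
move=> hZ' hB' ZZ BB onto; split.
  apply: (fgm_im (f := f)) => // [u /ZZ //|u /BB //|v Zv].
  have [u uv] := onto v Zv; exists u; first by apply/ZZ; rewrite uv.
  by rewrite uv subrr; apply: submodp0.
move=> /(fgm_pull hR f hZ' hB').
by apply: fgm_same => u; [apply: iff_sym | move/BB].
Qed.

Lemma fg_module_sub (V : lmodType R) (S : submodClosed V) :
  fg_module (submod_of S) <-> fgm (fun x => x \in S) (eq^~ 0).
Proof.
rewrite fg_moduleP.
apply: (fgm_equiv (f := @submod_incl _ _ S)).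
- exact: submodp_closed.
- exact: submodp_zero.
- by move=> u; split=> // _; exact: valP.
- by move=> u; split=> [->|/= e]; [rewrite linear0 | exact: val_inj].
by move=> v vS; exists (exist _ v vS).
Qed.

Lemma fg_module_quotmod (V : lmodType R) (S : submodClosed V) :
  fg_module (quotmod S) <-> fgm (fun _ : V => True) (fun x => x \in S).
Proof.
rewrite fg_moduleP; apply: iff_sym.
apply: (fgm_equiv (f := @quotmod_pi _ _ S)) => //.
- exact: submodp_zero.
- by move=> u; rewrite quotmod_pi_eq0.
by move=> v _; exact: quotmod_pi_surj.
Qed.

Lemma fg_module_kernel (U V : lmodType R) (f : {linear U -> V}) :
  fg_module (kernel f) <-> fgm (fun x => f x = 0) (eq^~ 0).
Proof.
rewrite fg_module_sub; split; apply: fgm_same => // x; split=> /eqP //.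
Qed.

Lemma fg_module_cohomology (U V W : lmodType R) (f : {linear U -> V})
    (g : {linear V -> W}) :
  fg_module (cohomology f g) <->
  fgm (fun x => g x = 0) (fun x => exists u, f u = x).
Proof.
rewrite fg_module_quotmod.
apply: (fgm_equiv (f := @submod_incl _ _ (ker_pred g))).
- exact: (submodp_preim g (submodp_zero _)).
- split=> [|a _ _ [x <-] [y <-]]; first by exists 0; rewrite linear0.
  by exists (a *: x + y); rewrite linearP.
- by move=> u; split=> // _; exact/eqP/(valP u).
- by move=> u; split=> /asboolP.
by move=> v /eqP vK; exists (exist _ v vK).
Qed.

Section Basis.
Variables (T : choiceType) (L : lmodType R).

(** The isomorphism of Hom(R^(T), L) with L^T, which turns the complex defining [Ext] into cochains
    on cells. *)
Definition on_basis (h : Defs.Hom {freeg T / R} L) : T -> L :=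
  fun x => val h << x >>.

Fact on_basis_is_linear : linear on_basis.
Proof. by []. Qed.
HB.instance Definition _ :=
  GRing.isLinear.Build R (Defs.Hom {freeg T / R} L) (T -> L) *:%R on_basis
    on_basis_is_linear.

Lemma flift_hom (c : T -> L) : (@flift R T L c : _ -> L) \in @hom_pred R {freeg
  T / R} L.
Proof. by apply/asboolP => a x y; rewrite linearP. Qed.

Lemma on_basis_surj c : exists h, on_basis h = c.
Proof.
exists (exist (fun h => h \in @hom_pred R {freeg T / R} L) _ (flift_hom c));
  apply/funext => x.
exact: fliftE.
Qed.

Lemma on_basisK (h : Defs.Hom {freeg T / R} L) D : flift (on_basis h) D = val h
  D.
Proof.
have /asboolP lh := valP h.
pose hL := GRing.isLinear.Build R {freeg T / R} L *:%R (val h) lh.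
pose H : {linear {freeg T / R} -> L} := HB.pack (val h) hL.
exact: (@flift_unique _ _ _ _ H).
Qed.

Lemma on_basis_eq0 h : on_basis h = 0 -> h = 0.
Proof.
move=> h0; apply: val_inj; apply/funext => D; rewrite -on_basisK h0.
have -> // := @flift_unique R T L 0 (\0 : {linear {freeg T / R} -> L}) _ D.
Qed.

End Basis.

Variables (M L : lmodType R).

Lemma on_basis_dual n (h : Defs.Hom (free_res M n) L) :
  @on_basis (syzygy M n.+1) L (hom_dual (free_res_d M n) h) =
  @cobd R M L n.+1 (@on_basis (syzygy M n) L h).
Proof.
apply/funext => s; rewrite /= on_basisK /on_basis /=; congr (_ (submod_incl _)).
by rewrite /free_aug liftU scale1r.
Qed.

Lemma fg_Ext n : fg_module (Ext n M L) <-> fgH M L n.+1.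
Proof.
case: n => [|n].
  rewrite /Ext fg_module_kernel.
  apply: (fgm_equiv (f := @on_basis (syzygy M 0) L)).
  - exact: cocycle_submodp.
  - exact: coboundary_submodp.
  - move=> h; rewrite /cocycle -on_basis_dual; split=> [->|/on_basis_eq0 //].
    exact: linear0.
  - move=> h; split=> [->|[u uh]].
      rewrite linear0; exact: submodp0 (coboundary_submodp _ _ _).
    by apply: on_basis_eq0; rewrite -[LHS]uh.
  by move=> c _; exact: on_basis_surj.
rewrite /Ext fg_module_cohomology.
apply: (fgm_equiv (f := @on_basis (syzygy M n.+1) L)).
- exact: cocycle_submodp.
- exact: coboundary_submodp.
- move=> h; rewrite /cocycle -on_basis_dual; split=> [->|/on_basis_eq0 //].
  exact: linear0.
- move=> h; split=> [[k <-]|[u uh]].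
    by exists (@on_basis (syzygy M n) L k); rewrite -on_basis_dual.
  have [k kP] := on_basis_surj u; exists k.
  apply/eqP; rewrite -subr_eq0; apply/eqP/on_basis_eq0.
  rewrite linearB /= on_basis_dual kP; apply/eqP; rewrite subr_eq0; exact/eqP.
by move=> c _; exact: on_basis_surj.
Qed.

End ExtCochain.

(** * Comparison with other resolutions *)

Lemma free_aug1 (R : comNzRingType) (M : lmodType R) (x : M) :
  free_aug (<< x >> : free_cover M) = x.
Proof. by rewrite /free_aug liftU scale1r. Qed.

Lemma kernel_lift (R : comNzRingType) (U V W : lmodType R)
    (g : {linear V -> W}) (h : {linear U -> V}) :
  (forall x, g (h x) = 0) ->
  exists k : {linear U -> kernel g}, forall x, submod_incl (k x) = h x.
Proof.
move=> gh; have hK x : h x \in ker_pred g by exact/eqP.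
pose k x : kernel g := exist (fun y => y \in ker_pred g) _ (hK x).
have lk : linear k by move=> a x y; apply: val_inj; rewrite /= linearP.
pose kL := GRing.isLinear.Build R U (kernel g) *:%R k lk.
by exists (HB.pack k kL : {linear U -> kernel g}).
Qed.

Section Syzygy.
Variable R : comNzRingType.

Section Cocycle.
Variables (M L : lmodType R) (n : nat).
Implicit Types c : syzygy M n -> L.

(** The formal combination [D] expressing linearity at [a], [s], [t] is itself a syzygy, so a
    cocycle vanishes on it. *)
Lemma cocycle_linear c : @cocycle R M L n.+1 c -> linear c.
Proof.
move=> Zc a s t.
pose D : free_cover (syzygy M n) := << a *: s + t >> - (a *: << s >> + << t >>).
have DK : D \in ker_pred (@free_aug R (syzygy M n)).
  by apply/eqP; rewrite /D linearB linearP /= !free_aug1 subrr.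
have := congr1 (@^~ (exist _ D DK : syzygy M n.+1)) Zc.
rewrite [LHS]/= /D linearB linearP /= !fliftE => /eqP.
by rewrite subr_eq0 => /eqP.
Qed.

Lemma linear_cocycle c : linear c -> @cocycle R M L n.+1 c.
Proof.
move=> lc; apply/funext => s /=.
pose cL := GRing.isLinear.Build R (syzygy M n) L *:%R c lc.
pose C : {linear syzygy M n -> L} := HB.pack c cL.
pose h : {linear {freeg (syzygy M n) / R} -> L} := C \o @free_aug R (syzygy M
  n).
rewrite (@flift_unique _ _ _ _ h) => [|x]; last by rewrite /= free_aug1.
rewrite /h /= (_ : free_aug _ = 0); last exact/eqP/(valP s).
exact: (linear0 C).
Qed.

Lemma cocycle_as_linear c : @cocycle R M L n.+1 c ->
  exists C : {linear syzygy M n -> L}, C =1 c.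
Proof.
move=> /cocycle_linear lc.
pose cL := GRing.isLinear.Build R (syzygy M n) L *:%R c lc.
by exists (HB.pack c cL : {linear syzygy M n -> L}).
Qed.

End Cocycle.

(** With [cocycle_linear], this reads Ext^{n+1} as linear maps on a syzygy modulo those that extend
    to the free module around it. *)
Lemma extension_coboundary (M L : lmodType R) n
    (h : {linear free_cover (syzygy M n) -> L}) :
  @coboundary R M L n.+2 (fun s : syzygy M n.+1 => h (submod_incl s)).
Proof.
exists (fun t : syzygy M n => h << t >>); apply/funext => s.
exact: (@flift_unique _ _ _ _ h).
Qed.

(* This passes to syzygies. It is used with [a = 1] and [K] finitely generated,
   where it replaces comparison with a resolution by finitely generated free
   modules, and with [K = 0], where it says that [a] acts as 0 on Ext. *)
Definition factors_through (a : R) (S K : lmodType R) : Prop :=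
  exists (T : choiceType) (u : {linear S -> K}) (w : {linear K -> S})
    (p : {linear S -> {freeg T / R}}) (q : {linear {freeg T / R} -> S}),
    forall s, a *: s = w (u s) + q (p s).

(** The maps of the factorization are lifted to the free covers and restricted to the kernels, up to
    an error controlled by [h]. *)
Lemma factors_syzygy (a : R) (S K : lmodType R) (T : choiceType)
    (pi : {linear {freeg T / R} -> K}) :
  (forall y, exists x, pi x = y) -> factors_through a S K ->
  exists (u : {linear kernel (@free_aug R S) -> kernel pi})
    (w : {linear kernel pi -> kernel (@free_aug R S)})
    (h : {linear free_cover S -> kernel (@free_aug R S)}),
    forall s, a *: s = w (u s) + h (submod_incl s).
Proof.
move=> pi_surj [T' [u [w [p [q upq]]]]].
have aug_surj y : exists x, @free_aug R S x = y by exists << y >>;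
  exact: free_aug1.
have [u1 u1P] := freeg_lift_surj (u \o @free_aug R S) pi_surj.
have [w1 w1P] := freeg_lift_surj (w \o pi) aug_surj.
have [q1 q1P] := freeg_lift_surj (q) aug_surj.
pose i := @submod_incl R _ (ker_pred (@free_aug R S)).
have augi s : @free_aug R S (i s) = 0 by exact/eqP/(valP s).
have pii (s : kernel pi) : pi (submod_incl s) = 0 by exact/eqP/(valP s).
have [|u2 u2P] := kernel_lift (g := pi) (h := u1 \o i).
  by move=> s; rewrite /= u1P /= augi linear0.
have [|w2 w2P] := kernel_lift (g := @free_aug R S)
    (h := w1 \o @submod_incl R _ (ker_pred pi)).
  by move=> s; rewrite /= w1P /= pii linear0.
(* The failure of the lifts to add up to [a]; the augmentation kills it, so it takes values in the
   syzygies. *)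
pose h1 : {linear free_cover S -> free_cover S} :=
  ( *:%R a \- (w1 \o u1)) \- (q1 \o (p \o @free_aug R S)).
have [|h hP] := kernel_lift (g := @free_aug R S) (h := h1).
  move=> x; rewrite /h1 /= !linearB /= linearZ /= w1P /= u1P /= q1P.
  by rewrite upq addrAC addrK subrr.
exists u2, w2, h => s; apply: val_inj.
rewrite -[RHS]/(submod_incl (w2 (u2 s)) + submod_incl (h (i s))).
by rewrite w2P hP /= u2P /= augi !linear0 addr0 addrC subrK.
Qed.


Section Resolution.
Variables (P : lmodType R -> Prop) (a : R).
Hypothesis P_syzygy : forall K, P K ->
  exists (T : choiceType) (pi : {linear {freeg T / R} -> K}),
    (forall y, exists x, pi x = y) /\ P (kernel pi).

Lemma factors_res (M : lmodType R) n :
  (exists2 K, P K & factors_through a M K) ->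
  exists2 K, P K & exists (u : {linear syzygy M n.+1 -> K})
    (w : {linear K -> syzygy M n.+1})
    (h : {linear free_cover (syzygy M n) -> syzygy M n.+1}),
    forall s : syzygy M n.+1, a *: s = w (u s) + h (submod_incl s).
Proof.
elim: n => [|n IH] H.
  have [K PK MK] := H; have [T [pi [pi_surj PK']]] := P_syzygy PK.
  by exists (kernel pi) => //; apply: factors_syzygy.
have [K PK [u [w [h uwh]]]] := IH H.
have [T [pi [pi_surj PK']]] := P_syzygy PK.
exists (kernel pi) => //; apply: (@factors_syzygy a (syzygy M n.+1)) => //.
(* The error term passes through [free_cover (syzygy M n)], so the conclusion is again a
   factorization up to a free module. *)
by exists (syzygy M n), u, w, (@submod_incl R _ _), h.
Qed.

End Resolution.

(** On a syzygy, multiplication by [a] is the restriction of a map defined on the free module around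
    it, so a times a cocycle extends there. *)
Lemma annihilator_kills (a : R) (M L : lmodType R) :
  (forall m : M, a *: m = 0) ->
  forall n (c : cell M n.+1 -> L), cocycle c -> coboundary (a *: c).
Proof.
move=> aM [|n] c Zc.
  have [C CE] := cocycle_as_linear Zc.
  rewrite (_ : a *: c = 0); first exact: submodp0 (coboundary_submodp _ _ _).
  apply/funext => m.
  by rewrite -[LHS]/(a *: c m) -(CE m) -linearZ /= aM linear0.
(* Zero modules, covered by the free module on the empty set. *)
pose P (K : lmodType R) := forall y : K, y = 0.
have [||K PK [u [w [h uwh]]]] := @factors_res P a _ M n.
- move=> K PK; exists void, (\0 : {linear {freeg void / R} -> K});
  split=> [y|[x xK]].
    by exists 0; rewrite (PK y) linear0.
  apply: val_inj => /=; apply: (@freeg_ind R void (fun x => x = 0)) => [|[]].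
  exact: submodp_zero.
- exists {freeg void / R}.
    by apply: freeg_ind => [|[]]; exact: submodp_zero.
  by exists M, \0, \0, \0, \0 => s; rewrite /= aM addr0.
have [C CE] := cocycle_as_linear Zc.
have [v vP] := extension_coboundary (n := n) (C \o h); exists v.
rewrite vP; apply/funext => s.
rewrite -[RHS]/(a *: c s) -(CE s) -linearZ /= uwh (PK (u s)) linear0 add0r //.
Qed.

Section Finiteness.
Hypothesis hR : noetherian R.

Lemma fg_cover (K : lmodType R) : fg_module K ->
  exists (T : choiceType) (pi : {linear {freeg T / R} -> K}),
    (forall y, exists x, pi x = y) /\ fg_module (kernel pi).
Proof.
move=> [s sP]; pose b := size s.
pose pi : {linear {freeg 'I_b / R} -> K} := @flift R 'I_b K (fun i => s`_i).
exists 'I_b, pi; split=> [y|].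
  have [c ->] := (sP y).1 isT; exists (\sum_i c i *: << i >>).
  by rewrite linear_sum; apply: eq_bigr => i _; rewrite linearZ /= fliftE.
apply/(fg_module_kernel hR).
have fgF : fgm (fun _ : {freeg 'I_b / R} => True) (eq^~ 0).
  exists [seq << i >> | i <- enum 'I_b]; split=> // D _; move: D.
  apply: freeg_ind => [|i]; first exact: gen_submodp (submodp_zero _).
  apply: gen_mem; first exact: submodp_zero.
  by apply: map_f; rewrite mem_enum.
apply: (fgm_subset hR _ _ _ fgF) => //; first exact: submodp_zero.
exact: (submodp_preim pi (submodp_zero _)).
Qed.

Section Evaluation.
Variables (T : Type) (L : lmodType R).

Definition ev (x : T) (c : T -> L) : L := c x.

Fact ev_is_linear x : linear (ev x).
Proof. by []. Qed.
HB.instance Definition _ x :=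
  GRing.isLinear.Build R (T -> L) L *:%R (ev x) (ev_is_linear x).

(** Evaluation at finitely many points embeds [Z], modulo the functions vanishing there, in a finite
    power of [L]. *)
Lemma fgm_ev (K : eqType) (k : K -> T) (s : seq K) (Z B : (T -> L) -> Prop) :
  fgm (fun _ : L => True) (eq^~ 0) -> submodp Z ->
  fgm (fun c => Z c /\ forall x, x \in s -> c (k x) = 0) B -> fgm Z B.
Proof.
move=> fgL; elim: s Z => [|x s IH] Z hZ.
  by apply: fgm_same => // c; split=> [[]|].
move=> H; apply: (fgm_kernel hR (f := ev (k x)) hZ (submodp_zero _) _ fgL) =>
  //.
apply: IH.
  apply: submodp_setI => //; exact: (submodp_preim (ev (k x)) (submodp_zero _)).
apply: fgm_same H => // c; split=> [[Zc cs]|[[Zc cx] cs]].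
  split=> [|y ys]; last by apply: cs; rewrite inE ys orbT.
  by split=> //; apply: (cs x); rewrite mem_head.
by split=> // y; rewrite inE => /predU1P[->|/cs].
Qed.

End Evaluation.

(** The canonical resolution is not finitely generated, but up to coboundaries a cocycle is
    determined by its values on the images of finitely many generators of some [K]. *)
Lemma fgH_of_fg (M L : lmodType R) : fg_module M -> fg_module L ->
  forall n, fgH M L n.
Proof.
move=> fgM /fg_moduleP fgL [|n]; first exact: fgH0.
have [K fgK [u [w uw]]] : exists2 K, fg_module K &
    exists (u : {linear syzygy M n -> K}) (w : {linear K -> syzygy M n}),
    forall c, @cocycle R M L n.+1 c -> (forall y, c (w y) = 0) ->
      @coboundary R M L n.+1 c.
  case: n => [|n].
    exists M => //; exists idfun, idfun => c _ c0.
    rewrite (_ : c = 0); first exact: submodp0 (coboundary_submodp _ _ _).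
    exact/funext.
  (* With a = 1, the identity of the syzygy factors through [K] up to a map that extends to the free
     module. *)
  have [||K fgK [u [w [h uwh]]]] := @factors_res (@fg_module R) 1 _ M n.
  - exact: fg_cover.
  - exists M => //; exists M, idfun, idfun, \0, \0 => s.
    by rewrite /= scale1r addr0.
  exists K => //; exists u, w => c /cocycle_as_linear[C CE] cw.
  have [v vP] := extension_coboundary (n := n) (C \o h); exists v.
  rewrite vP; apply/funext => s.
  by rewrite -CE -[in RHS](scale1r s) uwh linearD /= (CE (w _)) cw add0r.
have /fg_moduleP[t [_ tK]] := fgK.
apply: (@fgm_ev _ _ _ w t) => //; first exact: cocycle_submodp.
apply: fgm_triv => c [Zc ct]; apply: uw => // y.
have [C CE] := cocycle_as_linear Zc.
rewrite -CE; apply: (gen_min (C := fun y => C (w y) = 0)) (tK y Logic.I).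
- exact: (submodp_preim (C \o w) (submodp_zero _)).
- by move=> x xt; rewrite CE ct.
by move=> _ ->; rewrite !linear0.
Qed.

End Finiteness.

End Syzygy.

Section HomQuotient.
Variables (R : comNzRingType) (I : submodClosed R^o) (L : lmodType R).

(** Evaluation at the class of 1 identifies Hom(R/I, L) with the submodule of [L] killed by [I]. *)
Lemma fgH1_torsion : fgH (quotmod I) L 1 ->
  fgm (fun m : L => forall x : R^o, x \in I -> (x : R) *: m = 0) (eq^~ 0).
Proof.
pose e : quotmod I := quotmod_pi I 1.
apply: (fgm_im (f := @ev R (quotmod I) L e)).
- exact: submodp_zero.
- move=> c /cocycle_as_linear[C CE] x xI.
  change ((x : R) *: c e = 0).
  rewrite -(CE e) -linearZ /= -linearZ /= (_ : quotmod_pi I _ = 0) ?linear0 //.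
  by apply/quotmod_pi_eq0; rewrite -[_ *: _]/((x : R) * 1) mulr1.
- by move=> c [u <-].
move=> m mI; exists (fun z : quotmod I => (repr z : R) *: m).
  apply: linear_cocycle => a z w.
  apply/eqP; rewrite -subr_eq0 scalerA -scalerDl -scalerBl; apply/eqP/mI.
  apply/quotmod_pi_eq0; rewrite linearB /= quotmod_piK.
  rewrite -[(a * repr z + repr w : R)]/(a *: (repr z : R^o) + repr w : R^o).
  by rewrite linearP /= !quotmod_piK subrr.
rewrite /ev /= -{1}[m]scale1r -scalerBl; apply: mI.
by apply/quotmod_pi_eq0; rewrite linearB /= quotmod_piK subrr.
Qed.

End HomQuotient.

(** * Primes and supports *)

Section MakePrime.
Variables (R : comNzRingType) (J : R -> Prop).

Definition primep : Prop :=
  [/\ submodp (J : R^o -> Prop), ~ J 1 & forall a b, J (a * b) -> J a \/ J b].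

Hypothesis hJ : primep.

Definition primep_pred of primep : {pred R} := fun x => `[< J x >].

Fact primep_idealr_closed : idealr_closed (primep_pred hJ).
Proof.
have [hS J1 _] := hJ; split; first exact/asboolP/(submodp0 hS).
  by apply/asboolP.
by move=> a u v /asboolP Ju /asboolP Jv; apply/asboolP; apply: hS.2.
Qed.
HB.instance Definition _ := isIdealr.Build R (primep_pred hJ)
  primep_idealr_closed.

Fact primep_prime_closed : prime_idealr_closed (primep_pred hJ).
Proof.
have [_ _ hM] := hJ; move=> u v /asboolP /hM [] Jx; apply/orP; [left|right];
  exact/asboolP.
Qed.
HB.instance Definition _ := isPrimeIdealrClosed.Build R (primep_pred hJ)
  primep_prime_closed.

Definition of_primep : prime_idealr R := primep_pred hJ.

Lemma of_primepE x : x \in of_primep <-> J x.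
Proof. by split=> [/asboolP|?]; last apply/asboolP. Qed.

End MakePrime.

Section QuotientPrime.
Variables (R : comNzRingType) (p q : prime_idealr R).
Hypothesis pq : {subset p <= q}.

Lemma idealr_mull (I : prime_idealr R) a x : x \in I -> a * x \in I.
Proof. by move=> xI; rewrite prime_idealrM xI orbT. Qed.

Lemma repr_quot_mem (x : R) : (repr (\pi_{ideal_quot p} x) \in q) = (x \in q).
Proof.
have : repr (\pi_{ideal_quot p} x) - x \in q.
  by apply: pq; rewrite Quotient.idealrBE reprK.
move=> e; apply/idP/idP => xq.
  by rewrite -[x](subKr (repr (\pi_{ideal_quot p} x))) rpredB.
by rewrite -[repr _](subrK x) rpredD.
Qed.

(** The ideal q/p of R/p, read on representatives: these are determined modulo p, which lies in
    q. *)
Lemma quot_primep : primep (fun z : {ideal_quot p} => repr z \in q).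
Proof.
split.
- split=> [|a x y xq yq];
  first by rewrite -(rmorph0 \pi_{ideal_quot p}) repr_quot_mem rpred0.
  rewrite -[a]reprK -[x]reprK -[y]reprK.
  rewrite (_ : _ + _ = \pi_{ideal_quot p} (repr a * repr x + repr y)).
    by rewrite repr_quot_mem rpredD // idealr_mull.
  by rewrite rmorphD rmorphM.
- by rewrite -(rmorph1 \pi_{ideal_quot p}) repr_quot_mem idealr1.
move=> a b; rewrite -{1}[a]reprK -{1}[b]reprK -rmorphM repr_quot_mem.
by rewrite prime_idealrM => /orP.
Qed.

Definition quot_prime := of_primep quot_primep.

Lemma quot_primeE (x : R) : (\pi_{ideal_quot p} x \in quot_prime) = (x \in q).
Proof.
by apply/idP/idP => [/of_primepE|xq]; [|apply/of_primepE];
  rewrite repr_quot_mem.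
Qed.

End QuotientPrime.

Section Spectrum.
Variable R : comNzRingType.
Implicit Types p q : prime_idealr R.

Definition prime_lt p q : Prop := {subset p <= q} /\ ~ {subset q <= p}.

Lemma krull_dim_le1 p q q' :
  krull_dim_le {ideal_quot p} 1 -> prime_lt p q -> prime_lt q q' -> False.
Proof.
move=> dimp [pq qp] [qq' q'q].
have pp : {subset p <= p} by [].
have pq' : {subset p <= q'} by move=> x /pq /qq'.
(* The chain p/p < q/p < q'/p, continued by a constant. *)
pose c n := match n with 0 => quot_prime pp | 1 => quot_prime pq
            | _ => quot_prime pq' end.
have step (r r' : prime_idealr R) (pr : {subset p <= r}) (pr' : {subset p <=
  r'}) :
    {subset r <= r'} -> ~ {subset r' <= r} ->
    {subset quot_prime pr <= quot_prime pr'} /\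
    ~ {subset quot_prime pr' <= quot_prime pr}.
  move=> rr' r'r; split=> [z|sub];
    first by rewrite -[z]reprK !quot_primeE => /rr'.
  by apply: r'r => x xr'; rewrite -(quot_primeE pr) sub // quot_primeE.
have : (2 <= 1)%N by apply: (dimp 2%N c); case=> [|[|//]] _; exact: step.
by [].
Qed.

Lemma in_suppP p (L : lmodType R) :
  in_supp p L <-> exists m : L, forall s, s \notin p -> s *: m <> 0.
Proof.
have one_p : 1 \notin p by rewrite idealr1.
split=> [[z z0]|[m hm]].
  exists (repr z).1 => s sp e; apply: z0; rewrite -[z]reprK /loc0.
  apply/eqmodP; apply/asboolP; exists s => //=.
  by rewrite scaler0 subr0 scale1r.
exists (\pi_(localization p L) (m, exist _ 1 one_p)) => /eqmodP /asboolP[s sp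
  /=].
by rewrite !scale1r subr0; apply: hm.
Qed.

Lemma in_supp_inj p (U V : lmodType R) (f : {linear U -> V}) :
  (forall x, f x = 0 -> x = 0) -> in_supp p U -> in_supp p V.
Proof.
move=> f_inj /in_suppP[m hm]; apply/in_suppP; exists (f m) => s sp.
by rewrite -linearZ => /f_inj; apply: hm.
Qed.

Lemma in_supp_surj p (U V : lmodType R) (f : {linear U -> V}) :
  (forall y, exists x, f x = y) -> in_supp p V -> in_supp p U.
Proof.
move=> f_surj /in_suppP[m hm]; have [x fx] := f_surj m.
apply/in_suppP; exists x => s sp e; apply: (hm s sp).
by rewrite -fx -linearZ e linear0.
Qed.

(** By [torsionP], this says that the localizations of [L] at the primes in [B] vanish. *)
Definition torsion (B : prime_idealr R -> Prop) (L : lmodType R) : Prop :=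
  forall p, B p -> forall m : L, exists2 s, s \notin p & s *: m = 0.

Definition pow_torsion (x : R) (L : lmodType R) : Prop :=
  forall m : L, exists n, x ^+ n *: m = 0.

Lemma torsion_inj B (U V : lmodType R) (f : {linear U -> V}) :
  (forall x, f x = 0 -> x = 0) -> torsion B V -> torsion B U.
Proof.
move=> f_inj tV p Bp m; have [s sp sm] := tV p Bp (f m).
by exists s => //; apply: f_inj; rewrite linearZ.
Qed.

Lemma pow_torsion_inj x (U V : lmodType R) (f : {linear U -> V}) :
  (forall x, f x = 0 -> x = 0) -> pow_torsion x V -> pow_torsion x U.
Proof.
move=> f_inj tV m; have [n xn] := tV (f m).
by exists n; apply: f_inj; rewrite linearZ.
Qed.

Lemma pow_torsion_surj x (U V : lmodType R) (f : {linear U -> V}) :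
  (forall y, exists x, f x = y) -> pow_torsion x U -> pow_torsion x V.
Proof.
move=> f_surj tU y; have [m <-] := f_surj y; have [n xn] := tU m.
by exists n; rewrite -linearZ /= xn linear0.
Qed.

Lemma torsionP B (L : lmodType R) :
  torsion B L <-> forall p, B p -> ~ in_supp p L.
Proof.
split=> [tL p /tL tp /in_suppP[m hm]|nL p Bp m].
  by have [s sp /hm] := tp m; apply.
apply: contrapT => h; apply: (nL p Bp); apply/in_suppP; exists m => s sp e.
by apply: h; exists s.
Qed.

Definition coheight_ge2 p : Prop :=
  exists q q', prime_lt p q /\ prime_lt q q'.

Lemma dim_le1_torsion (L : lmodType R) :
  dim_le L 1 -> torsion coheight_ge2 L.
Proof.
move=> dimL; apply/torsionP => p [q [q' [pq qq']]] /dimL /krull_dim_le1.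
by apply; eassumption.
Qed.

Lemma sum_cyclic_sub (V : lmodType R) (T : V -> Prop) (x : V) :
  submodp T -> [/\ submodp (gen [:: x] T), forall y, T y -> gen [:: x] T y
    & gen [:: x] T x].
Proof.
move=> hT; split; first exact: gen_submodp.
  by move=> y; apply: gen_sub.
by apply: gen_mem => //; rewrite mem_head.
Qed.

Hypothesis hR : noetherian R.

Lemma fg_ring : fgm (fun _ : R^o => True) (eq^~ 0).
Proof. exact: noetherian_fgm. Qed.

(** Otherwise choice gives a strictly ascending chain, whose union is finitely generated and hence
    reached at a finite stage. *)
Lemma noetherian_max (V : lmodType R) (W : V -> Prop)
    (P : (V -> Prop) -> Prop) (T0 : V -> Prop) :
  fgm W (eq^~ 0) -> (forall T, P T -> submodp T /\ forall x, T x -> W x) ->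
  P T0 ->
  exists2 T, P T &
    forall T', P T' -> (forall x, T x -> T' x) -> forall x, T' x -> T x.
Proof.
move=> fgW PW PT0; apply: contrapT => nomax.
have step (T : {T | P T}) : exists T' : {T | P T},
    (forall x, sval T x -> sval T' x) /\ exists2 x, sval T' x & ~ sval T x.
  apply: contrapT => noT'; apply: nomax; exists (sval T);
    first exact: (svalP T).
  move=> T' PT' TT' x T'x; apply: contrapT => Tx.
  by apply: noT'; exists (exist _ T' PT'); split=> //; exists x.
have [next nextP] := choice step.
pose c n : {T | P T} := iter n next (exist _ T0 PT0).
have c_mono m n x : (m <= n)%N -> sval (c m) x -> sval (c n) x.
  move=> /subnK <-; elim: (n - m)%N => //= k IH cx.
  exact: (nextP _).1 _ (IH cx).
have hc n : submodp (sval (c n)) by case: (PW _ (svalP (c n))).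
pose U x := exists n, sval (c n) x.
have hU : submodp U.
  split=> [|a x y [m cx] [n cy]]; first by exists 0; exact: submodp0.
  exists (maxn m n); apply: (hc _).2.
    by apply: c_mono cx; rewrite leq_maxl.
  by apply: c_mono cy; rewrite leq_maxr.
have [|s [sU Us]] := fgm_subset hR (submodp_zero _) hU _ fgW.
  by move=> x [n cx]; apply: (PW _ (svalP (c n))).2.
have [N sN] : exists N, forall x, x \in s -> sval (c N) x.
  elim: s sU {Us} => [|y s IH] sU; first by exists 0.
  have [|N sN] := IH; first by move=> x xs; apply: sU; rewrite inE xs orbT.
  have [n cy] := sU y (mem_head _ _).
  exists (maxn n N) => x; rewrite inE => /predU1P[->|/sN].
    by apply: c_mono cy; rewrite leq_maxl.
  by apply: c_mono; rewrite leq_maxr.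
have [_ [x cx ncx]] := nextP (c N); apply: ncx.
apply: (gen_min (hc N) sN) (Us x _) => [_ ->|]; first exact: submodp0.
by exists N.+1.
Qed.

(** An ideal maximal among those containing [J] and no power of [x] is prime: if x^m = ra and x^n =
    tb modulo [T], then ab in [T] puts x^(m+n) in [T]. *)
Lemma prime_avoiding (J : R^o -> Prop) (x : R) :
  submodp J -> (forall n, ~ J (x ^+ n)) ->
  exists2 p : prime_idealr R, forall a, J a -> a \in p & x \notin p.
Proof.
move=> hJ Jx.
pose P (T : R^o -> Prop) :=
  [/\ submodp T, forall a, J a -> T a & forall n, ~ T (x ^+ n)].
have [||T [hT JT Tx] Tmax] := @noetherian_max R^o (fun=> True) P J fg_ring.
- by move=> T [].
- by [].
have bigger a : ~ T a -> exists n, gen [:: (a : R^o)] T (x ^+ n).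
  move=> Ta; apply: contrapT => h; apply: Ta.
  have [h1 h2 h3] := sum_cyclic_sub a hT.
  apply: (Tmax _ _ h2) => //; split=> // [b /JT /h2 //|n xn].
  by apply: h; exists n.
have pT : primep T.
  split=> // [|a b Tab]; first exact: (Tx 0%N).
  apply: contrapT => /not_orP[/bigger[m [r Tm]] /bigger[n [t Tn]]].
  apply: (Tx (m + n)%N).
  rewrite exprD (_ : _ * _ = x ^+ n *: (x ^+ m - r *: a : R^o) +
     ((r * a) *: (x ^+ n - t *: b : R^o) + (r * t) *: (a * b : R^o))) //.
    by apply: hT.2 => //; apply: hT.2 => //; apply: submodpZ.
  rewrite /GRing.scale /= !mulrBr addrA.
  by rewrite (mulrC (x ^+ n) (r * a)) subrKA mulrACA subrK mulrC.
exists (of_primep pT) => [a /JT Ta|]; first exact/of_primepE.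
by apply/negP => /(of_primepE pT) Txx; apply: (Tx 1%N); rewrite expr1.
Qed.

(** A maximal element among the annihilators of nonzero elements of W/(W ∩ T) is prime. *)
Lemma associated_prime (V : lmodType R) (T W : V -> Prop) (m : V) :
  submodp T -> submodp W -> W m -> ~ T m ->
  exists (p : prime_idealr R) (m0 : V), [/\ W m0, ~ T m0 & forall a, a \in p
    <-> T (a *: m0)].
Proof.
move=> hT hW Wm Tm.
pose ann y (a : R^o) := T ((a : R) *: y).
have hann y : submodp (ann y).
  split=> [|a b c Tb Tc]; rewrite /ann ?scale0r; first exact: submodp0.
  by rewrite scalerDl -scalerA; apply: hT.2.
pose P (J : R^o -> Prop) := exists2 y, W y /\ ~ T y & J = ann y.
have [||J [y [Wy Ty] ->] ymax] := @noetherian_max R^o (fun=> True) P (ann m)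
  fg_ring.
- by move=> _ [y _ ->]; split.
- by exists m.
have py : primep (ann y).
  split; [exact: hann | by rewrite /ann scale1r |].
  rewrite /ann => a b Tab.
  apply: contrapT => /not_orP[Ta Tb]; apply: Ta.
  apply: (ymax (ann (b *: y))); last by rewrite /ann scalerA.
    by exists (b *: y); split=> //; apply: submodpZ.
  by move=> c Tc; rewrite /ann scalerA mulrC -scalerA; apply: submodpZ.
by exists (of_primep py), y; split=> // a; rewrite of_primepE.
Qed.

(** If no power of [x] kills [m], a prime containing the annihilator of [m] but not [x] lies in the
    support. *)
Lemma supp_pow_torsion (L : lmodType R) (x : R) :
  (forall p, in_supp p L -> x \in p) -> pow_torsion x L.
Proof.
move=> suppL m; apply: contrapT => h.
have [||p annp xp] := @prime_avoiding (fun a => (a : R) *: m = 0) x.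
- split=> [|a b c eb ec]; first by rewrite scale0r.
  by rewrite scalerDl -scalerA eb ec scaler0 addr0.
- by move=> n xn; apply: h; exists n.
apply: (negP xp); apply: suppL; apply/in_suppP; exists m => s sp e.
by move: sp; rewrite annp.
Qed.

Lemma torsion_all (L : lmodType R) :
  torsion (fun=> True) L -> forall m : L, m = 0.
Proof.
(* The support is empty, so even x = 1 acts nilpotently on each element. *)
move=> tL m; have [|n] := @supp_pow_torsion L 1 _ m;
  last by rewrite expr1n scale1r.
by move=> p /in_suppP[y hy]; have [s /hy] := tL p Logic.I y.
Qed.

End Spectrum.

(** * Artinian modules up to a class of supports *)

Section Artinian.
Variable R : comNzRingType.

(* x / 1 lies in the localization of N at every prime satisfying B *)
Definition locally_in (B : prime_idealr R -> Prop) (V : lmodType R)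
    (N : V -> Prop) (x : V) : Prop :=
  forall p, B p -> exists2 s, s \notin p & N (s *: x).

Definition descending (V : lmodType R) (N : nat -> V -> Prop) : Prop :=
  (forall j, submodp (N j)) /\ forall j x, N j.+1 x -> N j x.

(** The descending chain condition up to [B]-torsion: the quotients of [N n] by later terms vanish
    at all primes of [B]. *)
Definition artinian (B : prime_idealr R -> Prop) (V : lmodType R)
    (T : V -> Prop) : Prop :=
  forall N, descending N -> (forall x, N 0 x -> T x) ->
  exists n, forall j, (n <= j)%N -> forall x, N n x -> locally_in B (N j) x.

(* Used when B' and B are the complements of {p | dim R/p <= d - 1} and
   {p | dim R/p <= d}. *)
Definition lowers (B' B : prime_idealr R -> Prop) : Prop :=
  forall p q, ~ B p -> prime_lt p q -> ~ B' q.

Variables (B : prime_idealr R -> Prop) (V : lmodType R).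
Implicit Types (S T W : V -> Prop) (N : nat -> V -> Prop).

Lemma locally_in_mono S T x :
  (forall y, S y -> T y) -> locally_in B S x -> locally_in B T x.
Proof. by move=> ST Sx p /Sx[s sp /ST]; exists s. Qed.

Lemma locally_in_sub S x : S x -> locally_in B S x.
Proof. by move=> Sx p Bp; exists 1; rewrite ?idealr1 ?scale1r. Qed.

Lemma descending_le N m n x : descending N -> (m <= n)%N -> N n x -> N m x.
Proof. by move=> [_ dN] /subnK <-; elim: (n - m)%N => //= k IH /dN. Qed.

(** (T + Rm)/T is R/p, and a proper quotient of R/p is supported at primes strictly above p, which
    [lowers] excludes from [B]. *)
Lemma artinian_extension B1 T (p : prime_idealr R) (m : V) :
  lowers B B1 -> submodp T -> (forall a, a \in p <-> T (a *: m)) -> ~ B1 p ->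
  artinian B T -> artinian B (gen [:: m] T).
Proof.
move=> BB1 hT pP nBp aT N dN NT; have [hN _] := dN.
have [||n0 n0P] := aT (fun j x => N j x /\ T x).
- split=> [j|j x [Nx Tx]]; first exact: submodp_setI.
  by split=> //; apply: descending_le Nx.
- by move=> x [].
(* Either the chain enters [T], or every term has nonzero image in R/p. *)
have [[j0 Nj0]|nonzero] := pselect (exists j, forall x, N j x -> T x).
  exists (maxn n0 j0) => j; rewrite geq_max => /andP[n0j j0j] x Nx.
  apply: locally_in_mono (n0P j n0j x _) => [y [] //|]; split.
    by apply: descending_le Nx; rewrite ?leq_maxl.
  by apply: Nj0; apply: descending_le Nx; rewrite ?leq_maxr.
exists n0 => j n0j x Nx q Bq.
(* Some b outside p has bm in N j + T. If all such multipliers were in q, then p < q, contrary to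
   [B q]. *)
have [s sq [y Ny Ty]] : exists2 s, s \notin q & exists2 y, N j y & T (s *: m -
  y).
  have [b [bp [y Ny Ty]]] :
      exists b, b \notin p /\ exists2 y, N j y & T (b *: m - y).
    apply: contrapT => h; apply: nonzero; exists j => y Ny.
    have [a Ta] : gen [:: m] T y by apply/NT/(descending_le dN (leq0n j)).
    have Ta' : T (a *: m - y) by rewrite -opprB; apply: submodpN.
    have [ap|ap] := boolP (a \in p); last by case: h; exists a; split=> //;
      exists y.
    rewrite -[y](subrK (a *: m)); apply: submodpD => //; exact/pP.
  have [bq|bq] := boolP (b \in q); last by exists b => //; exists y.
  apply: contrapT => h; apply: (BB1 p q nBp _ Bq); split.
    move=> s sp; apply: contrapT => /negP sq; apply: h; exists s => //.
    by exists 0; [exact: submodp0 | rewrite subr0; apply/pP].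
  by move=> /(_ b bq); apply/negP.
have [a Ta] : gen [:: m] T x by apply/NT/(descending_le dN (leq0n n0)).
(* Subtracting a multiple of [y] moves a multiple of [x] into [T], where the chain is already
   stationary. *)
have [|t tq [Nt _]] := n0P j n0j (s *: x - a *: y) _ q Bq.
  split; last first.
    rewrite (_ : _ - _ = s *: (x - a *: m) + a *: (s *: m - y)).
      by apply: submodpD => //; apply: submodpZ.
    by rewrite !scalerBr !scalerA (mulrC a s) addrA subrK.
  apply: submodpB => //; apply: submodpZ => //.
  exact: descending_le Ny.
exists (t * s); first by rewrite prime_idealrM negb_or tq.
rewrite -scalerA -[s *: x](subrK (a *: y)) scalerDr.
by apply: submodpD => //; do 2!apply: submodpZ => //.
Qed.

(** A maximal artinian submodule of [W] is all of [W]: otherwise an associated prime, outside [B1]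
    by torsion, would enlarge it. *)
Lemma artinian_fg (hR : noetherian R) B1 W :
  lowers B B1 -> torsion B1 V -> submodp W -> fgm W (eq^~ 0) -> artinian B W.
Proof.
move=> BB1 tV hW fgW.
pose P T := [/\ submodp T, forall x, T x -> W x & artinian B T].
have [||T [hT TW aT] Tmax] := noetherian_max hR (P := P) (T0 := eq^~ 0) fgW.
- by move=> T [].
- split; [exact: submodp_zero | by move=> _ ->; exact: submodp0 |].
  move=> N dN N0; exists 0%N => j _ x /N0 ->; apply: locally_in_sub.
  exact: submodp0 (dN.1 j).
have [WT|] := pselect (forall x, W x -> T x).
  by move=> N dN N0; apply: aT => // x /N0 /WT.
move=> /existsNP[m /not_implyP[Wm nTm]].
have [p [m0 [Wm0 nTm0 pP]]] := associated_prime hR hT hW Wm nTm.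
have [h1 h2 h3] := sum_cyclic_sub m0 hT.
case: nTm0; apply: (Tmax (gen [:: m0] T)) => //; split=> // [x|].
  by apply: gen_min => // y; rewrite inE => /eqP ->.
apply: (artinian_extension BB1 hT pP) => // Bp.
have [s /negP sp e] := tV p Bp m0; apply: sp; apply/pP; rewrite e.
exact: submodp0.
Qed.

Lemma artinian_pow_torsion (x : R) T :
  submodp T -> (forall m, T m -> exists n, x ^+ n *: m = 0) ->
  artinian B (fun m => T m /\ x *: m = 0) -> artinian B T.
Proof.
move=> hT xT aT N dN N0; have [hN _] := dN.
(* [L i j] copies the i-th layer of [N j] for the filtration by kernels of powers of [x] into the
   kernel of [x]; it decreases in both indices. *)
pose L i j y := exists2 m, N j m /\ x ^+ i.+1 *: m = 0 & x ^+ i *: m = y.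
have hL i j : submodp (L i j).
  apply: (submodp_im ( *:%R (x ^+ i) : {linear V -> V})).
  apply: submodp_setI; first exact: hN.
  exact: (submodp_preim ( *:%R (x ^+ i.+1) : {linear V -> V}) (submodp_zero _)).
have Lj i j k y : (j <= k)%N -> L i k y -> L i j y.
  by move=> jk [m [Nm xm] <-]; exists m => //; split=> //;
    apply: descending_le Nm.
have Li i k j y : (i <= k)%N -> L k j y -> L i j y.
  move=> /subnK <-; elim: (k - i)%N y => //= l IH y [m [Nm xm] <-]; apply: IH.
  exists (x *: m); last by rewrite scalerA -exprSr.
  by split; [apply: submodpZ | rewrite scalerA -exprSr].
have LT i j y : L i j y -> T y /\ x *: y = 0.
  move=> [m [Nm xm] <-]; split; last by rewrite scalerA -exprS.
  by apply: submodpZ => //; apply: N0; apply: descending_le Nm.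
(* The diagonal chain handles all layers i >= i0 at once; the finitely many others are handled one
   by one. *)
have [||i0 i0P] := aT (fun j => L j j).
- by split=> // j y;
  move/(Lj j.+1 j j.+1 y (leqnSn j))/(Li j j.+1 j y (leqnSn j)).
- by move=> y /LT.
have aL i : exists n, forall j, (n <= j)%N -> forall y, L i n y ->
    locally_in B (L i j) y.
  apply: aT => [|y /LT //].
  by split=> // j y; apply: Lj.
have [c cP] := choice aL.
pose n := maxn i0 (\max_(i < i0) c i).
have LP i j y : (n <= j)%N -> L i n y -> locally_in B (L i j) y.
  move=> nj; have [ii0|i0i] := ltnP i i0 => Ly.
    have cn : (c i <= n)%N by rewrite leq_max (leq_bigmax (Ordinal ii0)) orbT.
    by apply: cP; [exact: leq_trans nj | exact: Lj Ly].
  have Ly0 : L i0 i0 y by apply: (Li _ _ _ _ i0i); apply: Lj Ly;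
    rewrite leq_maxl.
  apply: locally_in_mono (i0P (maxn i j) _ y Ly0).
    move=> z Lz; apply: (Li i (maxn i j)); first by rewrite leq_maxl.
    by apply: Lj Lz; rewrite leq_maxr.
  by rewrite leq_max i0i.
exists n => j nj m Nm.
have [i xm] := xT m (N0 m (descending_le dN (leq0n n) Nm)).
(* Induction on the power of [x] killing [m]: correcting a multiple of [m] by an element of [N j]
   lowers it. *)
elim: i m Nm xm => [|i IH] m Nm xm.
  rewrite expr0 scale1r in xm; rewrite xm.
  by apply: locally_in_sub; exact: submodp0.
move=> q Bq; have [|s sq [m' [Nm' xm'] e]] := LP i j (x ^+ i *: m) nj _ q Bq.
  by exists m.
have [||t tq Nt] := IH (s *: m - m') _ _ q Bq.
- by apply: submodpB => //; [exact: submodpZ | exact: descending_le Nm'].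
- by rewrite scalerBr e !scalerA mulrC subrr.
exists (t * s); first by rewrite prime_idealrM negb_or tq.
rewrite -scalerA -[s *: m](subrK m') scalerDr; apply: submodpD => //.
exact: submodpZ.
Qed.

Definition kills (xs : seq R) (m : V) : Prop := forall x, x \in xs -> x *: m =
  0.

(** The conditions x m = 0 are removed one generator at a time. *)
Lemma kills_ind (P : (V -> Prop) -> Prop) (xs : seq R) T :
  (forall S S', (forall m, S m <-> S' m) -> P S -> P S') ->
  (forall S x, submodp S -> (forall m, S m -> T m) -> x \in xs ->
     P (fun m => S m /\ x *: m = 0) -> P S) ->
  submodp T -> P (fun m => T m /\ kills xs m) -> P T.
Proof.
move=> Pext; elim: xs T => [|x xs IH] T Pstep hT PT.
  by apply: Pext PT => m; split=> [[]|].
apply: (Pstep T x) => //; first by rewrite mem_head.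
have hTx : submodp (fun m => T m /\ x *: m = 0).
  apply: submodp_setI => //.
  exact: (submodp_preim ( *:%R x : {linear V -> V}) (submodp_zero _)).
apply: IH => // [S y hS ST yxs|].
  by apply: Pstep => //; [move=> m /ST [] | rewrite inE yxs orbT].
apply: Pext PT => m; split=> [[Tm xm]|[[Tm xm] xsm]].
  split; first by split=> //; apply: xm; rewrite mem_head.
  by move=> y yxs; apply: xm; rewrite inE yxs orbT.
by split=> // y; rewrite inE => /predU1P[->|/xsm].
Qed.

(** A relative form of Melkersson's criterion: the chain condition passes from the elements killed
    by [xs] to the whole module. *)
Lemma artinian_kills (hR : noetherian R) B1 (xs : seq R) :
  lowers B B1 -> torsion B1 V -> (forall x, x \in xs -> pow_torsion x V) ->
  fgm (kills xs) (eq^~ 0) -> artinian B (fun _ : V => True).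
Proof.
move=> BB1 tV xsV fgK; apply: (kills_ind (P := @artinian B V) (xs := xs)) => //.
- move=> S S' SS' aS N dN N0; apply: aS => // x /N0 /SS' //.
- move=> S x hS _ /xsV xV; apply: (@artinian_pow_torsion x S) => // m _;
  exact: xV.
have hK : submodp (kills xs).
  split=> [x _|a m m' km km' x xxs]; first by rewrite scaler0.
  by rewrite scalerDr scalerA mulrC -scalerA km ?km' // scaler0 addr0.
apply: (artinian_fg hR BB1 tV); first exact: submodp_setI.
by apply: fgm_same fgK => // m; split=> [|[]].
Qed.

Lemma fg_kills (hR : noetherian R) (xs : seq R) :
  (forall x, x \in xs -> exists n, forall m : V, x ^+ n *: m = 0) ->
  fgm (kills xs) (eq^~ 0) -> fg_module V.
Proof.
move=> xsV fgK; apply/fg_moduleP.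
apply: (kills_ind (P := fun T => fgm T (eq^~ 0)) (xs := xs)) => //.
- by move=> S S' SS'; apply: fgm_same.
- move=> S x hS _ /xsV[n xn] fgx.
  (* Multiplication by [x] sends the kernel of x^(k+1) to that of x^k, with kernel inside that of
     [x]. *)
  suff : forall k, fgm (fun m => S m /\ x ^+ k *: m = 0) (eq^~ 0).
    by move=> /(_ n); apply: fgm_same => // m; split=> [[]|].
  elim=> [|k IH].
    by apply: fgm_triv => m [_]; rewrite expr0 scale1r.
  apply: (fgm_kernel hR (f := *:%R x) _ (submodp_zero _) _ IH).
  + apply: submodp_setI => //.
    exact: (submodp_preim ( *:%R (x ^+ k.+1) : {linear V -> V}) (submodp_zero
      _)).
  + move=> m [Sm xm]; split; first exact: submodpZ.
    by rewrite /= scalerA -exprSr.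
  apply: fgm_same fgx => // m; split=> [[Sm xm]|[[]] //].
  by split=> //; split=> //; rewrite exprSr -scalerA xm scaler0.
by apply: fgm_same fgK => // m; split=> [|[]].
Qed.

End Artinian.

(** * Cofinite modules *)

Section Cofiniteness.
Variable R : comNzRingType.
Hypothesis hR : noetherian R.
Variable I : submodClosed R^o.

Let H (L : lmodType R) n := fgH (quotmod I) L n.

Let I_torsion (L : lmodType R) := forall x : R^o, x \in I -> pow_torsion x L.

Lemma fg_ring_quotient : fg_module (quotmod I).
Proof.
apply/(fg_module_quotmod hR); apply: fgm_sub (fg_ring hR) => _ ->.
exact: rpred0.
Qed.

Lemma ring_quotient_kill (x : R^o) : x \in I ->
  forall m : quotmod I, (x : R) *: m = 0.
Proof.
move=> xI m; have [a <-] := quotmod_pi_surj m.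
rewrite -linearZ /=; apply/quotmod_pi_eq0.
by rewrite -[_ *: _]/((x : R) * (a : R)) mulrC -[_ * _]/((a : R) *: x) rpredZ.
Qed.

(** Ext^0 of the image is controlled because the image embeds in [L]; with e <= 1 this gives enough
    degrees for the kernel, whose cofiniteness then gives one more degree for the image. *)
Lemma fgH_kernel_image (L : lmodType R) (f : {linear L -> L}) e :
  (e <= 1)%N -> (forall i, (i <= e.+1)%N -> H L i) ->
  ((forall i, (i <= e.+1)%N -> H (kernel f) i) -> forall n, H (kernel f) n) ->
  (forall n, H (kernel f) n) /\ (forall i, (i <= e.+1)%N -> H (image f) i).
Proof.
move=> e1 HL HK.
have Him i : (i <= e)%N -> H (image f) i.
  case: i => [|[|i]] ie; first exact: fgH0.
    exact: (fgH_left hR (short_exact_cokernel f) (HL 1%N isT) (fgH0 _ _)).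
  by have := leq_trans ie e1.
have HKn : forall n, H (kernel f) n.
  apply: HK => -[|i] ie; first exact: fgH0.
  by apply: (fgH_left hR (short_exact_kernel f)); [exact: HL | exact: Him].
split=> // i ie; apply: (fgH_right hR (short_exact_kernel f)) (HKn _).
exact: HL.
Qed.

(** Passage from [B']-torsion to [B]-torsion modules, one dimension up. The list [ys] holds the
    generators of [I] not yet known to be nilpotent on [L], and the bound [e.+1] means Ext^0, ...,
    Ext^e. *)
Lemma cofinite_step B' B e (xs : seq R^o) :
  (e <= 1)%N -> lowers B' B ->
  (forall x, x \in xs -> x \in I) ->
  (forall z, z \in I -> gen xs (eq^~ 0) z) ->
  (forall L : lmodType R, torsion B' L -> I_torsion L ->
     (forall i, (i <= e)%N -> H L i) -> forall n, H L n) ->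
  forall (ys : seq R^o) (L : lmodType R), torsion B L -> I_torsion L ->
    (forall i, (i <= e.+1)%N -> H L i) ->
    (forall x, x \in xs ->
       x \in ys \/ exists n, forall m : L, (x : R) ^+ n *: m = 0) ->
    forall n, H L n.
Proof.
move=> e1 B'B xsI Igen HB'.
have fgkills L : H L 1 -> fgm (@kills R L xs) (eq^~ 0).
  move=> /fgH1_torsion; apply: fgm_same => // m; split=> [h x /xsI /h //|h x].
  move=> /Igen; apply: (gen_min (C := fun x : R^o => (x : R) *: m = 0)) => //.
    split=> [|a b c eb ec]; first by rewrite scale0r.
    by rewrite scalerDl -scalerA eb ec scaler0 addr0.
  by move=> _ ->; rewrite scale0r.
elim=> [|x ys IH] L tL IL HL xsL.
  apply: (fgH_of_fg hR fg_ring_quotient).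
  apply: (fg_kills hR (xs := xs)); last by apply: fgkills; apply: HL.
  by move=> x /xsL[].
have [xxs|xxs] := boolP (x \in xs); last first.
  apply: IH => // y yxs; have [|] := xsL y yxs; last by right.
  by rewrite inE => /predU1P[e0|]; [move: xxs; rewrite -e0 yxs | left].
have xI := xsI x xxs.
(* On the kernel of a power of [x] in a submodule of [L], [x] is nilpotent, so [ys] suffices. *)
have kerIH (N : lmodType R) (f : {linear N -> L}) k (g : {linear N -> N}) :
    (forall m, f m = 0 -> m = 0) -> (forall m, g m = (x : R) ^+ k *: m) ->
    (forall i, (i <= e.+1)%N -> H (kernel g) i) -> forall n, H (kernel g) n.
  move=> f_inj gk.
  have i_inj : forall m : kernel g, f (submod_incl m) = 0 -> m = 0.
    by move=> m /f_inj m0; apply: val_inj.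
  pose fi : {linear kernel g -> L} := f \o @submod_incl R _ _.
  move=> Hg; apply: IH => // [|y yI|y yxs].
  - exact: (torsion_inj (f := fi)).
  - exact: (pow_torsion_inj (f := fi) i_inj (IL y yI)).
  have [|[n yn]] := xsL y yxs; last first.
    by right; exists n => m; apply: i_inj; rewrite -[f _]/(fi _) linearZ /= yn.
  rewrite inE => /predU1P[->|]; [right | by left].
  exists k => m; apply: val_inj; rewrite /= -gk; exact/eqP/(valP m).
have xsI_torsion y : y \in xs -> pow_torsion y L by move=> /xsI /IL.
have aL := artinian_kills hR B'B tL xsI_torsion (fgkills L (HL 1%N isT)).
pose N j (y : L) := exists2 m, True & ( *:%R ((x : R) ^+ j) : {linear L -> L})
  m = y.
have [|//|n nP] := aL N.
  split=> [j|j _ [m _ <-]]; first exact: (submodp_im _ (submodp_setT _)).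
  by exists ((x : R) *: m) => //=; rewrite scalerA -exprSr.
pose f : {linear L -> L} := *:%R ((x : R) ^+ n).
have [HKf Hf] := fgH_kernel_image e1 HL (@kerIH L idfun n f (fun _ => id) (fun
  _ => erefl)).
have [i_inj _ _] := short_exact_cokernel f.
pose g : {linear image f -> image f} := *:%R (x : R).
have [|HKg Hg] := @fgH_kernel_image _ g e e1 Hf.
  by apply: (@kerIH _ (@submod_incl R _ _) 1%N) => // m; rewrite expr1.
have tN : I_torsion (image f) := fun y yI => pow_torsion_inj i_inj (IL y yI).
(* With N = x^n L, the quotient N/xN is [B']-torsion by stationarity. Its degree i needs degree i +
   1 of xN, which is why one degree is lost. *)
have HC : forall k, H (cokernel g) k.
  apply: HB' => [p Bp y|y yI|i ie].
  - have [[z zf] <-] := quotmod_pi_surj y; have /asboolP[m fm] := zf.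
    have [|s sp [m' _ e']] := nP n.+1 (leqnSn n) (f m) _ p Bp;
      first by exists m.
    exists s => //; rewrite -linearZ /=; apply/quotmod_pi_eq0/asboolP.
    exists (to_image f m'); apply: val_inj => /=.
    by rewrite -fm -e' /= scalerA -exprS.
  - have [_ q_surj _] := short_exact_cokernel g.
    exact: (pow_torsion_surj q_surj (tN y yI)).
  apply: (fgH_right hR (short_exact_cokernel g)); last exact: Hg.
  by apply: Hf; apply: leqW.
move=> [|k]; first exact: fgH0.
apply: (fgH_mid hR (short_exact_kernel f)) ; first exact: HKf.
apply: (fgH_nilpotent hR (short_exact_kernel g) (short_exact_cokernel g));
  [|exact: HKg | exact: HC] => c Zc.
(* N -> xN -> N is multiplication by [x], which is 0 on cohomology because [x] kills R/I. *)
rewrite (_ : post _ _ = (x : R) *: c) //.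
by apply: annihilator_kills => //; apply: ring_quotient_kill.
Qed.

Definition nonmaximal (p : prime_idealr R) : Prop := exists q, prime_lt p q.

(** [cofinite_step] is used twice: from zero modules to dimension at most 0 with e = 0, then to
    dimension at most 1 with e = 1. *)
Lemma cofinite_dim_le1 (L : lmodType R) :
  torsion (@coheight_ge2 R) L -> I_torsion L -> H L 1 -> H L 2 ->
  forall n, H L n.
Proof.
have [xs [xsI Igen]] := (fg_submodP _).1 (hR I).
have H0 : forall L : lmodType R, torsion nonmaximal L -> I_torsion L ->
    (forall i, (i <= 1)%N -> H L i) -> forall n, H L n.
  move=> L' tL IL HL;
    apply: (@cofinite_step (fun=> True) nonmaximal 0 xs) => //.
  - by move=> p q np pq; case: np; exists q.
  - move=> L'' /(torsion_all hR) L0 _ _ n; apply: fgm_triv => c _.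
    rewrite (_ : c = 0); first exact: submodp0 (coboundary_submodp _ _ _).
    exact/funext.
  by move=> x xxs; left; exact: xxs.
move=> tL IL H1 H2;
  apply: (@cofinite_step nonmaximal (@coheight_ge2 R) 1 xs) => //.
- by move=> p q np pq [q' qq']; apply: np; exists q, q'.
- by case=> [|[|[|i]]] // _; exact: fgH0.
by move=> x xxs; left; exact: xxs.
Qed.

(** All Ext(R/I, S) are finitely generated, so the hypotheses pass to L/S and its cofiniteness
    passes back to [L]. *)
Lemma cofinite_FD_le1 (L : lmodType R) :
  (forall p : prime_idealr R, in_supp p L -> in_V I p) -> FD_le1 L ->
  H L 1 -> H L 2 -> forall n, H L n.
Proof.
move=> suppL [S [/fg_submodP fgS dimS]] H1 H2.
have HS : forall n, H (submod_of S) n.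
  apply: (fgH_of_fg hR fg_ring_quotient); exact/(fg_module_sub hR).
have qS := short_exact_quotmod S.
have HQ : forall n, H (quotmod S) n.
  apply: cofinite_dim_le1; first exact: dim_le1_torsion.
  - move=> x xI; apply: (pow_torsion_surj (quotmod_pi_surj (S := S))).
    by apply: (supp_pow_torsion hR) => p /suppL; apply.
  - exact: (fgH_right hR qS H1 (HS 2%N)).
  exact: (fgH_right hR qS H2 (HS 3%N)).
by move=> n; exact: (fgH_mid hR qS (HS n) (HQ n)).
Qed.

(** The quotient of [U] by the preimage of [S] embeds in V/S. *)
Lemma FD_le1_inj (U V : lmodType R) (f : {linear U -> V}) :
  (forall x, f x = 0 -> x = 0) -> FD_le1 V -> FD_le1 U.
Proof.
move=> f_inj [S [/fg_submodP fgS dimS]].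
have hT := submodp_preim f (submodp_closed S).
exists (of_submodp hT); split.
  apply/fg_submodP;
    apply: (fgm_same (Z := fun u => f u \in S) (B := eq^~ 0)) => //.
  - by move=> x; rewrite of_submodpE.
  apply: (fgm_kernel hR (f := f) hT (submodp_zero _) _ fgS) => //.
  by apply: fgm_triv => z [_ /f_inj].
move=> p /in_suppP[m hm]; apply: dimS; apply/in_suppP.
have [u um] := quotmod_pi_surj m; exists (quotmod_pi S (f u)) => s sp.
rewrite -linearZ /= => /quotmod_pi_eq0; rewrite -linearZ /= => sS.
by apply: (hm s sp); rewrite -um -linearZ /=; apply/quotmod_pi_eq0/of_submodpE.
Qed.

(** The quotient of [V] by f(S) is a quotient of U/S. *)
Lemma FD_le1_surj (U V : lmodType R) (f : {linear U -> V}) :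
  (forall y, exists x, f x = y) -> FD_le1 U -> FD_le1 V.
Proof.
move=> f_surj [S [/fg_submodP fgS dimS]].
have hT := submodp_im f (submodp_closed S).
exists (of_submodp hT); split.
  apply/fg_submodP.
  apply: (fgm_same (Z := fun y => exists2 x, x \in S & f x = y) (B := eq^~ 0))
    => //.
  - by move=> x; rewrite of_submodpE.
  apply: (fgm_im (f := f) (submodp_zero _) _ _ _ fgS) => [x xS|x ->|_ [x xS
    <-]].
  - by exists x.
  - by rewrite linear0.
  by exists x; rewrite ?subrr.
move=> p /in_suppP[m hm]; apply: dimS; apply/in_suppP.
have [v vm] := quotmod_pi_surj m; have [u uv] := f_surj v.
exists (quotmod_pi S u) => s sp.
rewrite -linearZ /= => /quotmod_pi_eq0 sS.
apply: (hm s sp); rewrite -vm -uv -!linearZ /=;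
  apply/quotmod_pi_eq0/of_submodpE.
by exists (s *: u).
Qed.

End Cofiniteness.

(** * Kernels and cokernels of maps between cofinite modules *)

Theorem theorem3p7 (R : comNzRingType) (hR : noetherian R)
    (I : submodClosed R^o) :
  abelian_subcategory (FD1_cof I).
Proof.
move=> M N f [[suppM extM] FDM] [[suppN extN] FDN].
have HM : forall n, fgH (quotmod I) M n.
  by case=> [|n]; [exact: fgH0 | apply/(fg_Ext hR)].
have HN : forall n, fgH (quotmod I) N n.
  by case=> [|n]; [exact: fgH0 | apply/(fg_Ext hR)].
have [k_inj _ _] := short_exact_kernel f.
have [_ c_surj _] := short_exact_cokernel f.
have suppK p : in_supp p (kernel f) -> in_V I p by move/(in_supp_inj
  k_inj)/suppM.
have FDK : FD_le1 (kernel f) := FD_le1_inj hR k_inj FDM.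
(* Ext^0 of the image embeds in that of [N]; this supplies Ext^1 of the kernel. *)
have Him1 : fgH (quotmod I) (image f) 1.
  exact: (fgH_left hR (short_exact_cokernel f) (HN 1%N) (fgH0 _ _)).
have HK : forall n, fgH (quotmod I) (kernel f) n.
  apply: (cofinite_FD_le1 hR suppK FDK).
    exact: (fgH_left hR (short_exact_kernel f) (HM 1%N) (fgH0 _ _)).
  exact: (fgH_left hR (short_exact_kernel f) (HM 2%N) Him1).
have Him n := fgH_right hR (short_exact_kernel f) (HM n) (HK n.+1).
have HC n := fgH_right hR (short_exact_cokernel f) (HN n) (Him n.+1).
split; (split; first split) => //.
- by move=> i; apply/(fg_Ext hR).
- by move=> p /(in_supp_surj c_surj) /suppN.
- by move=> i; apply/(fg_Ext hR).
exact: (FD_le1_surj c_surj FDN).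
Qed.
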